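(* Let $\mathbb{K}$ be an algebraically closed field of characteristic $p=2$, let $r\ge1$ be an integer not divisible by $2$, let $n\ge 1$, and let $I=\{0,1\}\subset\mathbb{K}$, $J=\{1,\dots,r\}$. Let $\boldsymbol{\lambda}\in \mathrm{Cont}_{2}(D_{r,n})/\sim$ be an equivalence class. Then there exists an irreducible completely splittable module $D^{\boldsymbol{\lambda}}$ whose weights are exactly the elements of $\boldsymbol{\lambda}$. $D^{\boldsymbol{\lambda}}$ has a basis $\{v_{(\alpha,j)} : (\alpha,j)\in \boldsymbol{\lambda}\}$ with a $D_{r,n}$-action given by $$t_{i}v_{(\alpha,j)}=\zeta_{j_{i}}v_{(\alpha,j)},\qquad x_{i}v_{(\alpha,j)}=\alpha_{i}v_{(\alpha,j)}\qquad (1\leq i\leq n),$$ and, for $1\le k\le n-1$: if $j_{k}\neq j_{k+1}$, then $f_{k}v_{(\alpha,j)}=v_{(s_{k}\alpha,s_{k}j)}$; if $j_{k}=j_{k+1}$, then $f_{k}v_{(\alpha,j)}=v_{(\alpha,j)}$. Moreover, all the irreducible completely splittable representations of $D_{r,n}$ can be obtained in this way.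
   Context: The degenerate affine Yokonuma-Hecke algebra $D_{r,n}$ is the associative unital $\mathbb{K}$-algebra generated by $t_1,\dots,t_n,f_1,\dots,f_{n-1},x_1,\dots,x_n$ with relations: $f_if_j=f_jf_i$ for $|i-j|\ge2$; $f_if_{i+1}f_i=f_{i+1}f_if_{i+1}$; $t_it_j=t_jt_i$; $f_it_j=t_{s_i(j)}f_i$ with $s_i=(i,i+1)$; $t_i^r=1$; $f_i^2=1$; $x_ix_j=x_jx_i$; $f_ix_{i+1}=x_if_i+e_i$ where $e_i=\frac1r\sum_{s=0}^{r-1}t_i^st_{i+1}^{-s}$; $f_ix_j=x_jf_i$ for $j\ne i,i+1$; $t_jx_i=x_it_j$ for all $i,j$. Let $\zeta\in\mathbb{K}$ be a primitive $r$-th root of unity and put $\zeta_k=\zeta^{k-1}$, $1\le k\le r$. All modules considered lie in the category $\mathrm{Rep}_I D_{r,n}$ of finite-dimensional $D_{r,n}$-modules on which the eigenvalues of the $x_i$ lie in $I$. For such a module $M$ and $(\alpha,j)=((\alpha_1,\dots,\alpha_n),(j_1,\dots,j_n))\in I^n\times J^n$, the weight space is $M_{(\alpha,j)}=\{m\in M: (x_i-\alpha_i)^Nm=(t_i-\zeta_{j_i})m=0\ \text{for all } 1\le i\le n \text{ and } N\gg0\}$; $(\alpha,j)$ is a weight of $M$ if $M_{(\alpha,j)}\ne0$. $M$ is completely splittable if the $x_i$ act semisimply on it. $\mathrm{Cont}_2(D_{r,n})$ is the set of all sequences $(\alpha,j)=((\alpha_1,\dots,\alpha_n),(j_1,\dots,j_n))\in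 I^n\times J^n$ such that $\alpha_i\neq\alpha_{i+1}$ whenever $j_i=j_{i+1}$ ($1\le i\le n-1$). The transposition $s_i$ is called admissible if $j_i\ne j_{i+1}$; it sends $(\alpha,j)$ to $(s_i\alpha,s_ij)$, obtained by exchanging the $i$-th and $(i+1)$-st entries of both $\alpha$ and $j$. The equivalence relation $\sim$ on $\mathrm{Cont}_2(D_{r,n})$ is: two elements are equivalent if one can be obtained from the other by a sequence of admissible transpositions.
   Formalization: The equivalence class λ is additionally assumed closed under admissible transpositions; Cont_2 itself is not closed (e.g. ((0,0,0),(1,2,1)) under s_1), and for a class that is not closed no module has exactly λ as its set of weights. *)

(* Defs.v *)
From HB Require Import structures.
From mathcomp Require Import all_boot all_order perm all_algebra.
From mathcomp Require Import boolp.
From mathcomp.multinomials Require Import monalg.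

Set Implicit Arguments.
Unset Strict Implicit.
Unset Printing Implicit Defensive.

Import GRing.Theory.
Local Open Scope ring_scope.
Local Open Scope quotient_scope.

(* For k : 'I_n.-1, the positions k and k+1 in 'I_n. *)
Fact lo_subproof n (k : 'I_n.-1) : (k < n)%N.
Proof. exact: leq_trans (ltn_ord k) (leq_pred n). Qed.
Fact hi_subproof n (k : 'I_n.-1) : (k.+1 < n)%N.
Proof. by case: n k => [|n] []. Qed.
Definition lo n (k : 'I_n.-1) : 'I_n := Ordinal (lo_subproof k).
Definition hi n (k : 'I_n.-1) : 'I_n := Ordinal (hi_subproof k).
Definition strans n (k : 'I_n.-1) : {perm 'I_n} := tperm (lo k) (hi k).

(* Quotient of an algebra by the two-sided ideal generated by the differences
   u - v for u, v related by rel. *)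
Section PresentedAlgebra.
Variables (K : comNzRingType) (A : lalgType K) (rel : A -> A -> Prop).

Inductive in_ideal : A -> Prop :=
| InIdealRel u v of rel u v : in_ideal (u - v)
| InIdeal0 : in_ideal 0
| InIdealD a b of in_ideal a & in_ideal b : in_ideal (a + b)
| InIdealMl a b of in_ideal b : in_ideal (a * b)
| InIdealMr a b of in_ideal a : in_ideal (a * b).

Definition ideal : {pred A} := [pred a | `[< in_ideal a >]].

Fact ideal_zmod_closed : zmod_closed ideal.
Proof.
split=> [|a b]; first by apply/asboolP; apply: InIdeal0.
move=> /asboolP Ia /asboolP Ib; apply/asboolP.
by apply: InIdealD => //; rewrite -mulN1r; apply: InIdealMl.
Qed.
HB.instance Definition _ := GRing.isZmodClosed.Build A ideal ideal_zmod_closed.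

Definition presented : Type := Quotient.quot ideal.
HB.instance Definition _ := GRing.Zmodule.on presented.

Definition pclass (a : A) : presented := \pi_(Quotient.quot ideal) a.

Lemma pclassP a b : pclass a = pclass b <-> in_ideal (a - b).
Proof.
rewrite /pclass; split=> [/eqP|Iab].
  by rewrite -Quotient.idealrBE => /asboolP.
by apply/eqP; rewrite -Quotient.idealrBE; apply/asboolP.
Qed.

Lemma pclass_repr (x : presented) : pclass (repr x) = x.
Proof. by rewrite /pclass reprK. Qed.

Lemma pclassD a b : pclass (a + b) = pclass a + pclass b.
Proof. by rewrite /pclass Quotient.pi_add. Qed.

Definition pone : presented := pclass 1.
Definition pmul (x y : presented) : presented := pclass (repr x * repr y).
Definition pscale (c : K) (x : presented) : presented := pclass (c *: repr x).

Lemma pclassM a b : pmul (pclass a) (pclass b) = pclass (a * b).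
Proof.
have /pclassP Ia := pclass_repr (pclass a).
have /pclassP Ib := pclass_repr (pclass b).
apply/pclassP; move: Ia Ib; set a' := repr _; set b' := repr _ => Ia Ib.
have ->: a' * b' - a * b = (a' - a) * b' + a * (b' - b).
  by rewrite mulrBl mulrBr addrA subrK.
by apply: InIdealD; [apply: InIdealMr|apply: InIdealMl].
Qed.

Lemma pclassZ c a : pscale c (pclass a) = pclass (c *: a).
Proof.
have /pclassP Ia := pclass_repr (pclass a).
apply/pclassP; rewrite -scalerBr -[_ - a]mul1r scalerAl.
exact: InIdealMl.
Qed.

Fact pmulA : associative pmul.
Proof.
move=> x y z; rewrite -(pclass_repr x) -(pclass_repr y) -(pclass_repr z).
by rewrite !pclassM mulrA.
Qed.
Fact pmul1 : left_id pone pmul.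
Proof. by move=> x; rewrite -(pclass_repr x) pclassM mul1r. Qed.
Fact pmulr1 : right_id pone pmul.
Proof. by move=> x; rewrite -(pclass_repr x) pclassM mulr1. Qed.
Fact pmulDl : left_distributive pmul +%R.
Proof.
move=> x y z; rewrite -(pclass_repr x) -(pclass_repr y) -(pclass_repr z).
by rewrite -pclassD !pclassM -pclassD mulrDl.
Qed.
Fact pmulDr : right_distributive pmul +%R.
Proof.
move=> x y z; rewrite -(pclass_repr x) -(pclass_repr y) -(pclass_repr z).
by rewrite -pclassD !pclassM -pclassD mulrDr.
Qed.
HB.instance Definition _ :=
  GRing.Zmodule_isPzRing.Build presented pmulA pmul1 pmulr1 pmulDl pmulDr.

Fact pscaleA a b x : pscale a (pscale b x) = pscale (a * b) x.
Proof. by rewrite -(pclass_repr x) !pclassZ scalerA. Qed.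
Fact pscale1 : left_id 1 pscale.
Proof. by move=> x; rewrite -(pclass_repr x) pclassZ scale1r. Qed.
Fact pscaleDr : right_distributive pscale +%R.
Proof.
move=> c x y; rewrite -(pclass_repr x) -(pclass_repr y) -pclassD !pclassZ.
by rewrite scalerDr pclassD.
Qed.
Fact pscaleDl x : {morph pscale^~ x : a b / a + b}.
Proof.
by move=> a b; rewrite -(pclass_repr x) !pclassZ scalerDl pclassD.
Qed.
HB.instance Definition _ := GRing.Zmodule_isLmodule.Build K presented
  pscaleA pscale1 pscaleDr pscaleDl.

End PresentedAlgebra.

Section YokonumaHecke.
Variables (K : fieldType) (r n : nat).

Definition gen : Type := ('I_n + 'I_n + 'I_n.-1)%type.
HB.instance Definition _ := Choice.on gen.

(* The free associative unital K-algebra on the symbols t_i, x_i, f_k. *)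
Definition free_alg : Type := {malg K[{fmonom gen}]}.
HB.instance Definition _ := GRing.Lalgebra.on free_alg.

Definition gen_mon (g : gen) : free_alg := << fmu g >>.
Definition gt (i : 'I_n) : free_alg := gen_mon (inl (inl i)).
Definition gx (i : 'I_n) : free_alg := gen_mon (inl (inr i)).
Definition gf (k : 'I_n.-1) : free_alg := gen_mon (inr k).

(* t_{k+1}^{-s} is written t_{k+1}^{r-s}, since t_{k+1}^r = 1. *)
Definition ge (k : 'I_n.-1) : free_alg :=
  r%:R^-1 *: \sum_(s < r) gt (lo k) ^+ s * gt (hi k) ^+ (r - s).

Inductive yh_rel : free_alg -> free_alg -> Prop :=
| RelFF (k l : 'I_n.-1) of (k.+1 < l)%N || (l.+1 < k)%N :
    yh_rel (gf k * gf l) (gf l * gf k)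
| RelBraid (k l : 'I_n.-1) of l = k.+1 :> nat :
    yh_rel (gf k * gf l * gf k) (gf l * gf k * gf l)
| RelTT i j : yh_rel (gt i * gt j) (gt j * gt i)
| RelFT k j : yh_rel (gf k * gt j) (gt (strans k j) * gf k)
| RelTr i : yh_rel (gt i ^+ r) 1
| RelF2 k : yh_rel (gf k ^+ 2) 1
| RelXX i j : yh_rel (gx i * gx j) (gx j * gx i)
| RelFXe k : yh_rel (gf k * gx (hi k)) (gx (lo k) * gf k + ge k)
| RelFX k j of j != lo k & j != hi k : yh_rel (gf k * gx j) (gx j * gf k)
| RelTX i j : yh_rel (gt j * gx i) (gx i * gt j).

Definition dyh : Type := presented yh_rel.
HB.instance Definition _ := GRing.PzRing.on dyh.
HB.instance Definition _ := GRing.Lmodule.on dyh.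

Definition dt (i : 'I_n) : dyh := pclass yh_rel (gt i).
Definition dx (i : 'I_n) : dyh := pclass yh_rel (gx i).
Definition df (k : 'I_n.-1) : dyh := pclass yh_rel (gf k).
Definition dscal (a : K) : dyh := a *: (1 : dyh).

Record dmod : Type := DMod {
  dmod_space :> vectType K;
  dact : {linear dyh -> 'End(dmod_space)};
  dact1 : dact 1 = \1%VF;
  dactM : forall a b, dact (a * b) = (dact a \o dact b)%VF
}.

Definition dmod_iso (M N : dmod) : Prop :=
  exists phi : {linear M -> N},
    bijective phi /\ forall a m, phi (dact M a m) = dact N a (phi m).

Definition submodule (M : dmod) (U : {vspace M}) : Prop :=
  forall a, (dact M a @: U <= U)%VS.

Definition irreducible (M : dmod) : Prop :=
  (0 < \dim {:M})%N /\
  forall U : {vspace M}, submodule U -> U = 0%VS \/ U = fullv.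

Definition semisimple_end (V : vectType K) (g : 'End(V)) : Prop :=
  forall U : {vspace V}, (g @: U <= U)%VS ->
  exists W : {vspace V},
    [/\ (g @: W <= W)%VS, (U + W = fullv)%VS & (U :&: W = 0)%VS].

Definition completely_splittable (M : dmod) : Prop :=
  forall i, semisimple_end (dact M (dx i)).

Definition I_vals : seq K := [:: 0; 1].

Definition in_Rep_I (M : dmod) : Prop :=
  forall i a, passmx.leigenvalue (dact M (dx i)) a -> a \in I_vals.

(* I^n x J^n; j : 'I_r stands for the element j+1 of J = {1, ..., r}, so that
   the root of unity zeta_{j+1} = zeta^{(j+1)-1} is zeta ^+ j. *)
Definition iseq : Type :=
  ({ffun 'I_n -> seq_sub I_vals} * {ffun 'I_n -> 'I_r})%type.
HB.instance Definition _ := Finite.on iseq.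

Definition ialpha (w : iseq) (i : 'I_n) : K := ssval (w.1 i).
Definition ires (w : iseq) (i : 'I_n) : 'I_r := w.2 i.

Section Weights.
Variables (zeta : K) (M : dmod).

Definition in_weight_space (w : iseq) (m : M) : Prop :=
  exists N0 : nat, forall N, (N0 <= N)%N -> forall i,
    dact M ((dx i - dscal (ialpha w i)) ^+ N) m = 0 /\
    dact M (dt i - dscal (zeta ^+ ires w i)) m = 0.

Definition is_weight (w : iseq) : Prop :=
  exists2 m : M, m != 0 & in_weight_space w m.
End Weights.

Definition Cont2 : {set iseq} :=
  [set w | [forall k : 'I_n.-1, (ires w (lo k) == ires w (hi k)) ==>
                                (ialpha w (lo k) != ialpha w (hi k))]].

Definition admissible (k : 'I_n.-1) (w : iseq) : bool :=
  ires w (lo k) != ires w (hi k).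

Definition swap (k : 'I_n.-1) (w : iseq) : iseq :=
  ([ffun i => w.1 (strans k i)], [ffun i => w.2 (strans k i)]).

Definition adm_step : rel iseq :=
  [rel w u | [exists k, admissible k w && (u == swap k w)]].

Definition adm_equiv : rel iseq := connect adm_step.

(* Cont2 is not stable under admissible transpositions: for n = 3 and r >= 2,
   ((0,0,0), (1,2,1)) lies in Cont2 but its image under s_1, ((0,0,0), (2,1,1)),
   does not.  A class of Cont2_quotient is therefore the part in Cont2 of an
   orbit, and adm_stable singles out the classes that are whole orbits. *)
Definition Cont2_quotient : {set {set iseq}} :=
  equivalence_partition adm_equiv Cont2.

Definition adm_stable (L : {set iseq}) : Prop :=
  forall w k, w \in L -> admissible k w -> swap k w \in L.

End YokonumaHecke.

(* Main.v *)
Require Import Defs.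
From HB Require Import structures.
From mathcomp Require Import fingroup perm all_boot all_order all_algebra.
From mathcomp Require Import boolp zify.
From mathcomp.multinomials Require Import monalg.

(** A simultaneous eigenvector of the [x_i] and [t_i] in an irreducible module
    can be moved, by admissible [f_k], to a vector [m] whose residues [j] are
    weakly increasing. When [j_k = j_(k+1)], semisimplicity of [x_k] forces
    [alpha_(k+1) = alpha_k + 1], and [f_k m - m] is zero or a vector of weight
    [s_k alpha], fixed by [f_k] since the characteristic is 2. As every weight
    lies in [Cont2], the latter happens only if the residue [j_k] occurs exactly
    twice, so the pairs of equal residues can be treated one at a time, which
    yields [m <> 0] fixed by all [f_k] with [j_k = j_(k+1)]. Sorting residues by
    adjacent transpositions is confluent, by the braid and commutation
    relations, so [m] extends to a family [u_w] of vectors of weight [w]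
    satisfying the formulas of [D^lambda], and Schur's lemma applies to
    [v_w |-> u_w]. *)

Set Implicit Arguments.
Unset Strict Implicit.
Unset Printing Implicit Defensive.

Import GRing.Theory.
Local Open Scope ring_scope.

(** * Modules built from operators assigned to the generators *)

Section Evaluation.
Variables (K : fieldType) (r n : nat) (V : vectType K).
Hypothesis V_gt0 : (0 < dim V)%N.
Variable h : gen n -> 'End(V).

(** [V_gt0] gives [1 != 0], which makes the endomorphisms a nontrivial ring; its product is
    composition in the order of [dactM]. *)
Local Notation S := (lfun_comp_nzRingType V_gt0).

Definition scal_end (c : K) : S := c *: \1%VF.

Fact scal_end_additive : additive scal_end.
Proof. by move=> a b; rewrite /scal_end scalerBl. Qed.
HB.instance Definition _ :=
  GRing.isAdditive.Build K S scal_end scal_end_additive.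

Lemma scal_endM c (g : S) : scal_end c * g = c *: (g : 'End(V)).
Proof.
by rewrite /scal_end; change ((c *: \1%VF \o g)%VF = c *: (g : 'End(V)));
  rewrite -comp_lfunZl comp_lfun1l.
Qed.

Fact scal_end_multiplicative : multiplicative scal_end.
Proof.
by split=> [a b|]; [rewrite scal_endM /scal_end scalerA | exact: scale1r].
Qed.
HB.instance Definition _ :=
  GRing.isMultiplicative.Build K S scal_end scal_end_multiplicative.

Definition word_end (m : {fmonom gen n}) : S :=
  foldr (fun g (f : S) => (h g : S) * f) 1 (fmonom_val m).

Fact word_end_mmorphism : mmorphism word_end.
Proof.
split=> [a b|]; last by rewrite /word_end fm1.
rewrite /word_end fmM; elim: (fmonom_val a) => [|g s IHs] /=.
  by rewrite mul1r.
by rewrite IHs mulrA.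
Qed.
HB.instance Definition _ :=
  isMultiplicative.Build {fmonom gen n} S word_end word_end_mmorphism.

Definition eval_end (a : free_alg K n) : 'End(V) := mmap scal_end word_end a.

Lemma eval_endD a b : eval_end (a + b) = eval_end a + eval_end b.
Proof. exact: (@mmapD _ _ S scal_end word_end). Qed.

Lemma eval_end0 : eval_end 0 = 0.
Proof. exact: (@mmap0 _ _ S scal_end word_end). Qed.

Lemma eval_endB a b : eval_end (a - b) = eval_end a - eval_end b.
Proof. exact: (@mmapB _ _ S scal_end word_end). Qed.

Lemma eval_endZ c a : eval_end (c *: a) = c *: eval_end a.
Proof. by rewrite /eval_end mmapZ scal_endM. Qed.

Fact eval_end_linear : linear eval_end.
Proof. by move=> c a b; rewrite eval_endD eval_endZ. Qed.
HB.instance Definition _ :=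
  GRing.isLinear.Build K (free_alg K n) 'End(V) *:%R eval_end eval_end_linear.

Lemma eval_end1 : eval_end 1 = \1%VF.
Proof. exact: (@mmap1 _ _ S scal_end word_end). Qed.

(** A monoid morphism extends multiplicatively to the monoid algebra once the images of scalars
    commute with those of monomials; here scalars act by multiples of the identity. *)
Lemma eval_endM a b : eval_end (a * b) = (eval_end a \o eval_end b)%VF.
Proof.
have H : multiplicative (mmap scal_end word_end).
  apply: commr_mmap_is_multiplicative => g m m'.
  rewrite /GRing.comm /= scal_endM /scal_end.
  change (g@_m *: (word_end m' : 'End(V)) = (word_end m' \o g@_m *: \1)%VF).
  by rewrite -comp_lfunZr comp_lfun1r.
exact: (H.1 a b).
Qed.

Lemma eval_end_gen g : eval_end (gen_mon K g) = h g.
Proof.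
rewrite /eval_end /gen_mon mmapU /= /scal_end scale1r /word_end fmU /= mulr1.
by rewrite mul1r.
Qed.

Hypothesis h_rel : forall a b, yh_rel r a b -> eval_end a = eval_end b.

Lemma eval_end_ideal a : in_ideal (@yh_rel K r n) a -> eval_end a = 0.
Proof.
elim=> {a} [a b /h_rel E||a b _ IHa _ IHb|a b _ IHb|a b _ IHa].
- by rewrite eval_endB E subrr.
- exact: eval_end0.
- by rewrite eval_endD IHa IHb addr0.
- by rewrite eval_endM IHb comp_lfun0r.
- by rewrite eval_endM IHa comp_lfun0l.
Qed.

Definition dyh_end (x : dyh K r n) : 'End(V) := eval_end (repr x).

Lemma dyh_endE a : dyh_end (pclass (@yh_rel K r n) a) = eval_end a.
Proof.
apply/eqP; rewrite -subr_eq0 -eval_endB; apply/eqP/eval_end_ideal.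
exact/pclassP/pclass_repr.
Qed.

Fact dyh_end_linear : linear dyh_end.
Proof.
move=> c x y; rewrite -(pclass_repr x) -(pclass_repr y).
have -> : c *: pclass (@yh_rel K r n) (repr x) = pclass _ (c *: repr x).
  exact: pclassZ.
by rewrite -pclassD !dyh_endE eval_endD eval_endZ.
Qed.
HB.instance Definition _ :=
  GRing.isLinear.Build K (dyh K r n) 'End(V) *:%R dyh_end dyh_end_linear.

Fact dyh_end1 : dyh_end 1 = \1%VF.
Proof. by rewrite -eval_end1; apply: dyh_endE. Qed.

Fact dyh_endM x y : dyh_end (x * y) = (dyh_end x \o dyh_end y)%VF.
Proof.
exact: etrans (dyh_endE _) (eval_endM _ _).
Qed.

Definition dmod_of_gens : dmod K r n := DMod dyh_end1 dyh_endM.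

Lemma dmod_of_gens_gen g (m : V) :
  dact dmod_of_gens (pclass (@yh_rel K r n) (gen_mon K g)) m = h g m.
Proof. by rewrite -eval_end_gen -dyh_endE. Qed.

End Evaluation.

(** Every element is the class of a linear combination of words in the generators: the induction
    runs over the letters of a word, then over the terms. It reduces intertwining to the
    generators. *)
Lemma dyh_ind (K : fieldType) (r n : nat) (P : dyh K r n -> Prop) :
    P 1 -> (forall x y, P x -> P y -> P (x + y)) ->
    (forall x y, P x -> P y -> P (x * y)) ->
    (forall c x, P x -> P (c *: x)) ->
    (forall i, P (dt K r i)) -> (forall i, P (dx K r i)) ->
    (forall k, P (df K r k)) ->
  forall x, P x.
Proof.
move=> P1 PD PM PZ Pt Px Pf x; rewrite -(pclass_repr x).
move: (repr x) => a {x}.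
pose cl b : dyh K r n := pclass (@yh_rel K r n) b; rewrite -/(cl a).
have clM b c : cl (b * c) = cl b * cl c by symmetry; apply: pclassM.
have clZ c b : cl (c *: b) = c *: cl b by symmetry; apply: pclassZ.
have Pmon s : P (cl << FMonom s >>).
  elim: s => [|g s IHs].
    have -> : << FMonom [::] >> = 1 :> free_alg K n.
      by congr << _ >>; apply: val_inj; rewrite /= fm1.
    exact: P1.
  have -> : << FMonom (g :: s) >> = gen_mon K g * << FMonom s >>.
    rewrite /gen_mon malgM_def fgmulUU mulr1; congr << _ >>.
    by apply: val_inj; rewrite /= fmM fmU.
  rewrite clM; apply: PM => //.
  by case: g => [[i|i]|k]; [exact: Pt|exact: Px|exact: Pf].
rewrite (monalgE a); elim/big_rec: _ => [|m b _ Pb].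
  rewrite -[0](scale0r (1 : free_alg K n)) clZ; apply/PZ/P1.
rewrite {1}/cl pclassD; apply: PD Pb.
have -> : << a@_m *g m >> = a@_m *: << m >> :> free_alg K n.
  by apply/malgP => k; rewrite mcoeffZ !mcoeffU mulr_natr.
by rewrite -/(cl _) clZ; apply: PZ; case: m => s; apply: Pmon.
Qed.

(** * Adjacent transpositions of weights and their braid relations *)

Section Swaps.
Variables (K : fieldType) (r n : nat).
Implicit Types (k l : 'I_n.-1) (w : iseq K r n) (i : 'I_n).

Lemma lo_neq_hi k : lo k != hi k.
Proof. by rewrite -val_eqE /= neq_ltn ltnSn. Qed.

Lemma hi_lo k l : l = k.+1 :> nat -> lo l = hi k.
Proof. by move=> kl; apply: val_inj. Qed.

Lemma stransK k : involutive (strans k).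
Proof. exact: tpermK. Qed.

Lemma strans_lo k : strans k (lo k) = hi k.
Proof. exact: tpermL. Qed.

Lemma strans_hi k : strans k (hi k) = lo k.
Proof. exact: tpermR. Qed.

Lemma strans_id k i : i != lo k -> i != hi k -> strans k i = i.
Proof. by rewrite eq_sym => ? /[1!eq_sym] ?; apply: tpermD. Qed.

Lemma strans_far k l i : (k.+1 < l)%N || (l.+1 < k)%N ->
  strans k (strans l i) = strans l (strans k i).
Proof.
move=> far; rewrite -!permM; congr (fun_of_perm _ i).
rewrite (conjgC (strans l)) tpermJ !strans_id // -val_eqE /=; lia.
Qed.

Lemma strans_braid k l i : l = k.+1 :> nat ->
  strans k (strans l (strans k i)) = strans l (strans k (strans l i)).
Proof.
move=> kl; have E := hi_lo kl; rewrite -!permM; congr (fun_of_perm _ i).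
have V m : (strans m)^-1%g = strans m by apply: tpermV.
(* Each triple product is one transposition conjugated by the other, hence the transposition of the
   two outer positions. *)
have Ek : (strans k * (strans l * strans k))%g = tperm (lo k) (hi l).
  by rewrite -{1}V -conjgE tpermJ E strans_hi strans_id // -val_eqE /=; lia.
have El : (strans l * (strans k * strans l))%g = tperm (lo k) (hi l).
  by rewrite -{1}V -conjgE tpermJ -E strans_lo strans_id // -val_eqE /=; lia.
by rewrite Ek El.
Qed.

Lemma ialpha_swap k w i : ialpha (swap k w) i = ialpha w (strans k i).
Proof. by rewrite /ialpha /= ffunE. Qed.

Lemma ires_swap k w i : ires (swap k w) i = ires w (strans k i).
Proof. by rewrite /ires /= ffunE. Qed.

Lemma swapK k : involutive (@swap K r n k).
Proof.
by case=> a j; congr (_, _); apply/ffunP=> i; rewrite !ffunE /= stransK.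
Qed.

Lemma swap_far k l w : (k.+1 < l)%N || (l.+1 < k)%N ->
  swap k (swap l w) = swap l (swap k w).
Proof.
by move=> far; congr (_, _); apply/ffunP=> i; rewrite !ffunE (strans_far _ far).
Qed.

Lemma swap_braid k l w : l = k.+1 :> nat ->
  swap k (swap l (swap k w)) = swap l (swap k (swap l w)).
Proof.
by move=> kl; congr (_, _); apply/ffunP=> i; rewrite !ffunE (strans_braid _ kl).
Qed.

Lemma iseq_eqP w u :
  ialpha w =1 ialpha u -> ires w =1 ires u -> w = u.
Proof.
case: w u => [a j] [b j'] /= Ea Ej; congr (_, _); apply/ffunP=> i.
  by apply: val_inj; apply: Ea.
exact: Ej.
Qed.

Lemma admissible_swap k w : admissible k (swap k w) = admissible k w.
Proof. by rewrite /admissible !ires_swap strans_lo strans_hi eq_sym. Qed.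

Lemma ires_swap_far k l w : (k.+1 < l)%N || (l.+1 < k)%N ->
  (ires (swap l w) (lo k) = ires w (lo k)) *
  (ires (swap l w) (hi k) = ires w (hi k)).
Proof.
by move=> far; rewrite !ires_swap !strans_id // -val_eqE /=; lia.
Qed.

Lemma ires_swap_next k l w : l = k.+1 :> nat ->
  [/\ ires (swap l w) (lo k) = ires w (lo k),
      ires (swap l w) (hi k) = ires w (hi l),
      ires (swap k w) (lo l) = ires w (lo k) &
      ires (swap k w) (hi l) = ires w (hi l)].
Proof.
move=> kl; have E := hi_lo kl; rewrite !ires_swap -E strans_lo E strans_hi.
by rewrite !strans_id // -val_eqE /=; lia.
Qed.

Lemma ires_swap_lo k w : ires (swap k w) (lo k) = ires w (hi k).
Proof. by rewrite ires_swap strans_lo. Qed.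

Lemma ires_swap_hi k w : ires (swap k w) (hi k) = ires w (lo k).
Proof. by rewrite ires_swap strans_hi. Qed.

(** The permutation of weights that [f_k] induces on the basis of [D^lambda]: where [s_k] is not
    admissible, [f_k] fixes the basis vector. *)
Definition cswap k w := if admissible k w then swap k w else w.

Lemma cswapK k : involutive (cswap k).
Proof.
move=> w; rewrite /cswap; case A: (admissible k w); last by rewrite A.
by rewrite admissible_swap A swapK.
Qed.

Lemma cswap_far k l w : (k.+1 < l)%N || (l.+1 < k)%N ->
  cswap k (cswap l w) = cswap l (cswap k w).
Proof.
move=> far; have far' : (l.+1 < k)%N || (k.+1 < l)%N by rewrite orbC.
have ak : admissible k (swap l w) = admissible k w.
  by rewrite /admissible !(ires_swap_far w far).
have al : admissible l (swap k w) = admissible l w.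
  by rewrite /admissible !(ires_swap_far w far').
rewrite /cswap; case A: (admissible k w); case B: (admissible l w);
  rewrite ?ak ?al ?A ?B //.
exact: swap_far.
Qed.

(** Which swaps take place depends only on the equalities among the residues at [lo k], [hi k] and
    [hi l]. If all differ, this is the braid relation of [swap]; if only the outer two agree, both
    sides return [w]. *)
Lemma cswap_braid k l w : l = k.+1 :> nat ->
  cswap k (cswap l (cswap k w)) = cswap l (cswap k (cswap l w)).
Proof.
move=> kl; have E := hi_lo kl.
have ak w' : admissible k w' = (ires w' (lo k) != ires w' (hi k)) by [].
have al w' : admissible l w' = (ires w' (hi k) != ires w' (hi l)).
  by rewrite /admissible E.
have N w' : (ires (swap l w') (lo k) = ires w' (lo k)) *
            (ires (swap l w') (hi k) = ires w' (hi l)) *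
            (ires (swap l w') (hi l) = ires w' (hi k)) *
            (ires (swap k w') (lo k) = ires w' (hi k)) *
            (ires (swap k w') (hi k) = ires w' (lo k)) *
            (ires (swap k w') (hi l) = ires w' (hi l)).
  have [N1 N2 _ N4] := ires_swap_next w' kl.
  by rewrite N1 N2 N4 ires_swap_lo !ires_swap_hi E.
pose R := (ak, al, N); rewrite /cswap !R.
case: (eqVneq (ires w (lo k)) (ires w (hi k))) => [ab|ab] /=;
case: (eqVneq (ires w (hi k)) (ires w (hi l))) => [bc|bc] /=;
rewrite ?R ?ab ?bc ?eqxx /= ?R ?(negPf ab) ?(negPf bc) /=.
- by rewrite bc eqxx.
- by rewrite ab eqxx.
- by rewrite -bc ab /= !R bc eqxx.
case: (eqVneq (ires w (lo k)) (ires w (hi l))) => [ac|ac] /=; rewrite !R.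
  by rewrite (eq_sym (ires w (hi k))) ab -ac ab !swapK.
by rewrite bc ab /= swap_braid.
Qed.

(** Termination measure for sorting: earlier positions have larger coefficients, so moving the
    larger of two adjacent residues to the right lowers the sum. *)
Definition weighted_res w := (\sum_(i < n) (n - i) * ires w i)%N.

Lemma weighted_res_swap k w : (ires w (hi k) < ires w (lo k))%N ->
  (weighted_res (swap k w) < weighted_res w)%N.
Proof.
move=> lt_res; rewrite /weighted_res.
have ne : hi k != lo k by rewrite eq_sym lo_neq_hi.
rewrite (bigD1 (lo k)) //= (bigD1 (hi k)) //= [ltnRHS](bigD1 (lo k)) //=.
rewrite [in ltnRHS](bigD1 (hi k)) //= ires_swap_lo ires_swap_hi !addnA.
set s := (\sum_(i < n | _) _)%N; set s' := (\sum_(i < n | _) _)%N.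
have -> : s = s'.
  apply: eq_bigr => i /andP[ilo ihi]; congr (_ * _)%N.
  by rewrite ires_swap strans_id.
have := hi_subproof k; nia.
Qed.

End Swaps.

(** * Linear algebra: eigenvectors and semisimple operators *)

Section Endomorphisms.
Import VectorInternalTheory.

(** The characteristic polynomial of the restriction of [g] to [U] has degree [\dim U > 0], hence a
    root. *)
Lemma stable_eigenvector (K : closedFieldType) (V : vectType K) (g : 'End(V))
    (U : {vspace V}) : (g @: U <= U)%VS -> U != 0%VS ->
  exists v a, [/\ v \in U, v != 0 & g v = a *: v].
Proof.
move=> gU U0; pose gr := v2r \o vsproj U \o g \o vsval \o @r2v _ (subvs_of U).
have /closed_rootP [a] : size (char_poly (lin1_mx gr)) != 1%N.
  by rewrite size_char_poly eqSS; rewrite -dimv_eq0 in U0.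
rewrite -eigenvalue_root_char => /eigenvalueP [x].
rewrite mul_rV_lin1 => gx x0; exists (vsval (r2v x)), a; split.
- exact: subvsP.
- rewrite -(linear0 (vsval (U := U))) (inj_eq subvs_inj).
  by rewrite -(linear0 r2v) (can_eq r2vK).
- rewrite -linearZ -linearZ -gx /= v2rK vsprojK //.
  exact/(subvP gU)/memv_img/subvsP.
Qed.

(** Induction on [s]: some eigenspace of [g] inside [U] is nonzero, and it is stable under the other
    operators because they commute with [g]. *)
Lemma stable_common_eigenvector (K : closedFieldType) (V : vectType K)
    (s : seq 'End(V)) (U : {vspace V}) :
    {in s, forall g : 'End(V), (g @: U <= U)%VS} ->
    {in s &, forall f g : 'End(V), forall m, f (g m) = g (f m)} ->
    U != 0%VS ->
  exists v, [/\ v \in U, v != 0 & forall g, g \in s -> exists a, g v = a *: v].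
Proof.
elim: s U => [|g s IHs] U sU sC U0.
  by exists (vpick U); split=> //; rewrite ?memv_pick ?vpick0.
have gs h : h \in s -> h \in g :: s by rewrite inE orbC => ->.
have [v [a [vU v0 gv]]] := stable_eigenvector (sU g (mem_head _ _)) U0.
pose W := (U :&: lker (g - a *: \1%VF))%VS.
have memW m : (m \in W) = (m \in U) && (g m == a *: m).
  by rewrite memv_cap memv_ker !lfun_simp /= subr_eq0.
have [h hs|f h /gs fs /gs hs|| u [uW u0 us]] := IHs W.
- apply/subvP=> _ /memv_imgP [m mW ->]; move: mW; rewrite !memW.
  case/andP=> mU /eqP gm; rewrite sC ?mem_head ?gs // gm linearZ eqxx andbT.
  exact/(subvP (sU h (gs _ hs)))/memv_img.
- exact: sC.
- by apply: contraNneq v0 => W0; rewrite -memv0 -W0 memW vU gv eqxx.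
move: uW; rewrite memW => /andP [uU /eqP gu]; exists u; split=> // h.
by rewrite inE => /orP [/eqP->|/us //]; exists a.
Qed.

(** Semisimplicity excludes Jordan blocks of size two. For a stable complement [W] of the kernel of
    [d = g - a], the vector [d m] equals [d w] with [w] in [W], so it lies in [W] and in the kernel,
    which meet in zero. *)
Lemma semisimple_eigenvector (K : fieldType) (V : vectType K) (g : 'End(V))
    (a : K) m : semisimple_end g ->
  g (g m - a *: m) = a *: (g m - a *: m) -> g m = a *: m.
Proof.
move=> ss; pose d := g - a *: \1%VF.
have dE u : d u = g u - a *: u by rewrite !lfun_simp.
rewrite -dE => /eqP; rewrite -subr_eq0 -dE => /eqP ddm.
have [|W [gW UW UW0]] := ss (lker d).
  apply/subvP=> _ /memv_imgP [u uK ->]; move: uK.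
  rewrite !memv_ker dE subr_eq0 => /eqP gu.
  by rewrite gu dE linearZ /= gu subrr.
have /memv_addP [u ud [w wW mE]] : m \in (lker d + W)%VS by rewrite UW memvf.
have dm : d m = d w.
  move: ud; rewrite memv_ker => /eqP ud.
  by rewrite mE linearD /= ud add0r.
suff : d m == 0 by rewrite dE subr_eq0 => /eqP.
rewrite -memv0 -UW0 memv_cap memv_ker ddm eqxx dm dE.
by rewrite memvB ?memvZ //; apply/(subvP gW)/memv_img.
Qed.

Lemma idempotent_semisimple (K : fieldType) (V : vectType K) (g : 'End(V)) :
  (forall m, g (g m) = g m) -> semisimple_end g.
Proof.
move=> gg U gU; pose p := projv U.
have gU' m : m \in U -> g m \in U by move=> mU; apply/(subvP gU)/memv_img.
(* The projection [p] onto [U], averaged so as to commute with [g]. *)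
pose q := ((g \o p \o g) + ((\1 - g) \o p \o (\1 - g)))%VF.
have qE m : q m = g (p (g m)) + (p (m - g m) - g (p (m - g m))).
  by rewrite !lfun_simp.
have qU m : q m \in U.
  by rewrite qE rpredD ?rpredB ?gU' ?memv_proj.
have qid m : m \in U -> q m = m.
  move=> mU; rewrite qE /p !projv_id ?rpredB ?gU' //.
  by rewrite linearB /= !gg subrr subr0 addrC subrK.
have gq m : g (q m) = q (g m).
  by rewrite !qE !gg subrr !linear0 addr0 linearD linearB /= !gg subrr.
exists (lker q); split.
- apply/subvP=> _ /memv_imgP [m mK ->]; move: mK.
  by rewrite !memv_ker -gq => /eqP ->; rewrite linear0.
- apply/eqP; rewrite eqEsubv subvf /=; apply/subvP => m _.
  have -> : m = q m + (m - q m) by rewrite addrC subrK.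
  by rewrite memv_add ?qU // memv_ker linearB /= (qid (q m)) ?qU // subrr.
- apply/eqP; rewrite -subv0; apply/subvP => m.
  by rewrite memv_cap memv_ker memv0 => /andP [/qid ->].
Qed.

End Endomorphisms.

(** * Action of [e_k] on joint eigenvectors of the [t_i] *)

Section IdempotentAction.
Variables (K : fieldType) (r n : nat) (zeta : K).
Hypotheses (r_neq0 : r%:R != 0 :> K) (zeta_prim : r.-primitive_root zeta).

Lemma prim_root_inj (a b : 'I_r) : zeta ^+ a = zeta ^+ b -> a = b.
Proof.
move/eqP; rewrite (eq_prim_root_expr zeta_prim) !modn_small // => /eqP.
exact: val_inj.
Qed.

(** The sum is geometric in [q = zeta ^+ a / zeta ^+ b]: each term is 1 if [a = b]; otherwise
    [q - 1] is nonzero and multiplies the sum to [q ^+ r - 1 = 0]. The exponent [r - s] stands for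
    [- s]. *)
Lemma root_orthogonality (a b : 'I_r) :
  r%:R^-1 * \sum_(s < r) (zeta ^+ a) ^+ s * (zeta ^+ b) ^+ (r - s)
    = (a == b)%:R.
Proof.
have zr c : (zeta ^+ c) ^+ r = 1.
  by rewrite -exprM mulnC exprM (prim_expr_order zeta_prim) expr1n.
have z0 : zeta != 0.
  apply/eqP=> z0; have := prim_expr_order zeta_prim.
  move/eqP; rewrite z0 expr0n gtn_eqF ?(prim_order_gt0 zeta_prim) //.
  by rewrite eq_sym oner_eq0.
pose q := zeta ^+ a / zeta ^+ b.
have -> : \sum_(s < r) (zeta ^+ a) ^+ s * (zeta ^+ b) ^+ (r - s)
          = \sum_(s < r) q ^+ s.
  apply: eq_bigr => s _; rewrite /q expr_div_n; congr (_ * _).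
  have zbs : (zeta ^+ b) ^+ s != 0 by rewrite !expf_neq0.
  apply: (mulIf zbs); rewrite mulVf // -exprD subnK ?zr //.
  exact: ltnW (ltn_ord s).
have [ab|/eqP ab] := altP (a =P b).
  rewrite (eq_bigr (fun=> 1)) => [|s _].
    by rewrite sumr_const card_ord mulVf.
  by rewrite /q ab divff ?expr1n // expf_neq0.
have q1 : q - 1 != 0.
  rewrite subr_eq0; apply: contra_not_neq ab => q1; apply: prim_root_inj.
  by move: q1 => /divr1_eq.
have : (q - 1) * \sum_(s < r) q ^+ s = 0.
  by rewrite -subrX1 /q expr_div_n !zr divr1 subrr.
by move/eqP; rewrite mulf_eq0 (negPf q1) /= => /eqP ->; rewrite mulr0.
Qed.

(** Stated for any representation [phi] of the free algebra, to serve both where the relations are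
    still to be verified and where they hold in a given module. The scalar comes from the
    orthogonality of roots of unity. *)
Lemma ge_eigen (V : vectType K) (phi : {linear free_alg K n -> 'End(V)})
    (phi1 : phi 1 = \1%VF)
    (phiM : forall a b, phi (a * b) = (phi a \o phi b)%VF)
    (k : 'I_n.-1) (a b : 'I_r) (m : V) :
  phi (gt K (lo k)) m = zeta ^+ a *: m ->
  phi (gt K (hi k)) m = zeta ^+ b *: m ->
  phi (ge K r k) m = (a == b)%:R *: m.
Proof.
move=> phia phib.
have phiX x c s : phi x m = c *: m -> phi (x ^+ s) m = c ^+ s *: m.
  move=> xm; elim: s => [|s IHs]; first by rewrite !expr0 phi1 id_lfunE scale1r.
  by rewrite exprS phiM comp_lfunE IHs linearZ /= xm scalerA exprSr.
rewrite /ge linearZ linear_sum scale_lfunE sum_lfunE.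
rewrite -root_orthogonality -scalerA.
congr (_ *: _); rewrite scaler_suml; apply: eq_bigr => s _.
have := phiX _ _ s phia; have := phiX _ _ (r - s)%N phib.
rewrite phiM comp_lfunE => ->; move: (phi _) => g; rewrite linearZ /= => ->.
by rewrite scalerA mulrC.
Qed.

End IdempotentAction.

(** * Operators on the functions on a finite set *)

Section FunctionSpace.
Variables (K : fieldType) (T : finType).
Local Notation V := {ffun T -> K^o}.

Definition delta_fun (w : T) : V := [ffun u => (u == w)%:R].

Lemma delta_funE (m : V) : m = \sum_w m w *: delta_fun w.
Proof.
apply/ffunP=> u; rewrite sum_ffunE (bigD1 u) //= big1 ?addr0 => [|w wu].
  by rewrite !ffunE eqxx [_ *: _]mulr1.
by rewrite !ffunE eq_sym (negPf wu) scaler0.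
Qed.

Lemma eq_end_delta (f g : 'End(V)) :
  (forall w, f (delta_fun w) = g (delta_fun w)) -> f = g.
Proof.
move=> fg; apply/lfunP=> m; rewrite (delta_funE m) !linear_sum.
by apply: eq_bigr => w _; rewrite !linearZ /= fg.
Qed.

Definition diag_fun (c : T -> K) (m : V) : V := [ffun u => c u *: m u].
Fact diag_fun_linear c : linear (diag_fun c).
Proof.
move=> a m m'; apply/ffunP=> u; rewrite !ffunE scalerDr !scalerA.
by rewrite [a * c u]mulrC.
Qed.
HB.instance Definition _ c :=
  GRing.isLinear.Build K V V *:%R (diag_fun c) (diag_fun_linear c).

Definition reindex_fun (s : T -> T) (m : V) : V := [ffun u => m (s u)].
Fact reindex_fun_linear s : linear (reindex_fun s).
Proof. by move=> a m m'; apply/ffunP=> u; rewrite !ffunE. Qed.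
HB.instance Definition _ s :=
  GRing.isLinear.Build K V V *:%R (reindex_fun s) (reindex_fun_linear s).

Lemma diag_delta c w : linfun (diag_fun c) (delta_fun w) = c w *: delta_fun w.
Proof.
rewrite lfunE; apply/ffunP=> u; rewrite !ffunE.
by case: eqP => [->|_] //; rewrite !scaler0.
Qed.

Lemma reindex_delta s w : involutive s ->
  linfun (reindex_fun s) (delta_fun w) = delta_fun (s w).
Proof.
move=> sK; rewrite lfunE; apply/ffunP=> u; rewrite !ffunE.
by rewrite (can2_eq sK sK).
Qed.

(** Lets a basis indexed by the type [T] be enumerated through a set [A] of another type; spanning
    suffices, since the number of vectors is the dimension. *)
Lemma delta_basis (S : finType) (A : {set S}) (f : S -> V) (g : T -> S) :
    injective g -> codom g =i A -> (forall w, f (g w) = delta_fun w) ->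
  basis_of fullv [seq f w | w <- enum A].
Proof.
move=> g_inj gA fg; rewrite basisEdim size_map -cardE dimvf.
have -> : dim V = #|T| by rewrite /dim /= muln1.
rewrite -(card_codom g_inj) (eq_card gA) leqnn andbT.
apply/subvP=> m _; rewrite (delta_funE m); apply: rpred_sum => w _.
apply: rpredZ; apply: memv_span; rewrite -fg; apply: map_f.
by rewrite mem_enum -gA codom_f.
Qed.

End FunctionSpace.

(** * Verification of the defining relations on weight vectors *)

Section WeightVectorRelations.
Variables (K : fieldType) (r n : nat) (zeta : K).
Hypotheses (charK : 2%N \in [pchar K]) (r_neq0 : r%:R != 0 :> K).
Hypothesis zeta_prim : r.-primitive_root zeta.

Lemma I_vals_neq (a b : K) : a \in I_vals K -> b \in I_vals K -> a != b ->
  a = b + 1.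
Proof.
rewrite !inE => /orP [] /eqP -> /orP [] /eqP ->; rewrite ?eqxx // ?add0r //.
by rewrite (addrr_pchar2 charK).
Qed.

Lemma ialphaP (w : iseq K r n) i : ialpha w i \in I_vals K.
Proof. exact: ssvalP. Qed.

Lemma Cont2_ialpha (w : iseq K r n) k : w \in Cont2 K r n ->
  ires w (lo k) = ires w (hi k) -> ialpha w (hi k) = ialpha w (lo k) + 1.
Proof.
rewrite inE => /forallP /(_ k) /implyP wC /eqP /wC.
by rewrite eq_sym; apply: I_vals_neq; apply: ialphaP.
Qed.

Lemma ires_cswap k (w : iseq K r n) i :
  ires (cswap k w) i = ires w (strans k i).
Proof.
rewrite /cswap; case: ifPn => [_|]; first exact: ires_swap.
rewrite negbK => /eqP E; have [->|ilo] := eqVneq i (lo k).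
  by rewrite strans_lo.
have [->|ihi] := eqVneq i (hi k); first by rewrite strans_hi.
by rewrite strans_id.
Qed.

Variables (V : vectType K) (phi : {linear free_alg K n -> 'End(V)}).
Hypotheses (phi1 : phi 1 = \1%VF).
Hypothesis phiM : forall a b, phi (a * b) = (phi a \o phi b)%VF.
Variables (T : Type) (wt : T -> iseq K r n).
Variables (s : 'I_n.-1 -> T -> T) (d : T -> V).
Hypotheses (wt_inj : injective wt) (wt_cont : forall w, wt w \in Cont2 K r n).
Hypothesis wt_s : forall k w, wt (s k w) = cswap k (wt w).
Hypothesis phi_t :
  forall i w, phi (gt K i) (d w) = zeta ^+ ires (wt w) i *: d w.
Hypothesis phi_x : forall i w, phi (gx K i) (d w) = ialpha (wt w) i *: d w.
Hypothesis phi_f : forall k w, phi (gf K k) (d w) = d (s k w).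

(** Since [wt] is injective, the relations among the [f_k] follow from those among the permutations
    [cswap k]; most of the others compare eigenvalues. *)
Lemma weight_vector_rel a b w : yh_rel r a b -> phi a (d w) = phi b (d w).
Proof.
have eM u v m : phi (u * v) m = phi u (phi v m) by rewrite phiM comp_lfunE.
have tX i e : phi (gt K i ^+ e) (d w) = (zeta ^+ ires (wt w) i) ^+ e *: d w.
  elim: e => [|e IHe]; first by rewrite !expr0 phi1 id_lfunE scale1r.
  by rewrite exprS eM IHe linearZ /= phi_t scalerA exprSr.
(* The generators are generalized in each case: unification would otherwise
   unfold the product of the free algebra. *)
case=> {a b} [k l far|k l kl|i j|k j|i|k|i j|k|k j jlo jhi|i j].
- move: (gf K) phi_f => F F_d; rewrite [LHS]eM [RHS]eM !F_d; congr d.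
  by apply: wt_inj; rewrite !wt_s cswap_far.
- move: (gf K) phi_f => F F_d; rewrite [LHS]eM [LHS]eM [RHS]eM [RHS]eM !F_d.
  by congr d; apply: wt_inj; rewrite !wt_s cswap_braid.
- move: (gt K) phi_t => t t_d.
  by rewrite [LHS]eM [RHS]eM !t_d !linearZ /= !t_d !scalerA mulrC.
- move: (gt K) phi_t (gf K) phi_f => t t_d F F_d.
  by rewrite [LHS]eM [RHS]eM t_d linearZ /= !F_d t_d wt_s ires_cswap stransK.
- rewrite tX phi1 id_lfunE -exprM mulnC exprM (prim_expr_order zeta_prim).
  by rewrite expr1n scale1r.
- move: (gf K) phi_f => F F_d; rewrite expr2 [LHS]eM !F_d phi1 id_lfunE.
  by congr d; apply: wt_inj; rewrite !wt_s cswapK.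
- move: (gx K) phi_x => x x_d.
  by rewrite [LHS]eM [RHS]eM !x_d !linearZ /= !x_d !scalerA mulrC.
- rewrite linearD add_lfunE.
  rewrite (ge_eigen r_neq0 zeta_prim phi1 phiM (phi_t _ w) (phi_t _ w)).
  move: (gx K) phi_x (gf K) phi_f => x x_d F F_d.
  rewrite [LHS]eM [in RHS]eM x_d linearZ /= !F_d x_d wt_s /cswap /admissible.
  have [E|E] /= := eqVneq; last by rewrite scale0r addr0 ialpha_swap strans_lo.
  (* Equal residues: [e_k] acts as 1 and [f_k] fixes [d w], so the relation asks for
     [alpha_(k+1) = alpha_k + 1], which [Cont2] guarantees. *)
  have -> : s k w = w by apply: wt_inj; rewrite wt_s /cswap /admissible E eqxx.
  by rewrite -scalerDl (Cont2_ialpha (wt_cont w) E).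
- move: (gx K) phi_x (gf K) phi_f => x x_d F F_d.
  rewrite [LHS]eM [RHS]eM x_d linearZ /= !F_d x_d wt_s; congr (_ *: _).
  by rewrite /cswap; case: ifP => // _; rewrite ialpha_swap strans_id.
- move: (gx K) phi_x (gt K) phi_t => x x_d t t_d.
  by rewrite [LHS]eM [RHS]eM x_d t_d !linearZ /= x_d t_d !scalerA mulrC.
Qed.

End WeightVectorRelations.

(** * The module attached to a stable class *)

Section ClassModule.
Variables (K : fieldType) (r n : nat) (zeta : K) (lam : {set iseq K r n}).
Hypotheses (charK : 2%N \in [pchar K]) (r_neq0 : r%:R != 0 :> K).
Hypothesis zeta_prim : r.-primitive_root zeta.
Hypothesis lam_cont : {subset lam <= Cont2 K r n}.
Hypothesis lam_stable : adm_stable lam.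

Definition class_idx := {w | w \in lam}.

Fact cswap_in (k : 'I_n.-1) (w : class_idx) : cswap k (val w) \in lam.
Proof. by rewrite /cswap; case: ifP => [/lam_stable->|_] //; apply: valP. Qed.

Definition class_swap k (w : class_idx) : class_idx :=
  exist [eta mem lam] _ (cswap_in k w).

Lemma class_swapK k : involutive (class_swap k).
Proof. by move=> w; apply: val_inj; rewrite /= cswapK. Qed.

Local Notation class_space := {ffun class_idx -> K^o}.

Definition class_gen (g : gen n) : 'End(class_space) :=
  match g with
  | inl (inl i) => linfun (diag_fun (fun w => zeta ^+ ires (val w) i))
  | inl (inr i) => linfun (diag_fun (fun w => ialpha (val w) i))
  | inr k => linfun (reindex_fun (class_swap k))
  end.

Variable w0 : class_idx.

Fact class_space_gt0 : (0 < dim class_space)%N.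
Proof. by rewrite /dim /= muln1; apply/card_gt0P; exists w0. Qed.

Local Notation ev := (eval_end class_space_gt0 class_gen).
Local Notation d := (@delta_fun K class_idx).

Lemma eval_t i w : ev (gt K i) (d w) = zeta ^+ ires (val w) i *: d w.
Proof. by rewrite eval_end_gen diag_delta. Qed.

Lemma eval_x i w : ev (gx K i) (d w) = ialpha (val w) i *: d w.
Proof. by rewrite eval_end_gen diag_delta. Qed.

Lemma eval_f k w : ev (gf K k) (d w) = d (class_swap k w).
Proof. by rewrite eval_end_gen reindex_delta //; apply: class_swapK. Qed.

Lemma class_gen_rel a b : yh_rel r a b -> ev a = ev b.
Proof.
move=> ab; apply: eq_end_delta => w.
apply: (weight_vector_rel charK r_neq0 zeta_prim (eval_end1 _ _) (eval_endM _ _)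
  val_inj _ _ eval_t eval_x eval_f w ab) => [u|k u] //.
exact: lam_cont (valP u).
Qed.

Definition class_module : dmod K r n := dmod_of_gens class_gen_rel.

Lemma class_module_t i w :
  dact class_module (dt K r i) (d w) = zeta ^+ ires (val w) i *: d w.
Proof.
by rewrite [LHS](dmod_of_gens_gen class_gen_rel (inl (inl i))) diag_delta.
Qed.

Lemma class_module_x i w :
  dact class_module (dx K r i) (d w) = ialpha (val w) i *: d w.
Proof.
by rewrite [LHS](dmod_of_gens_gen class_gen_rel (inl (inr i))) diag_delta.
Qed.

Lemma class_module_f k w :
  dact class_module (df K r k) (d w) = d (class_swap k w).
Proof.
rewrite [LHS](dmod_of_gens_gen class_gen_rel (inr k)) reindex_delta //.
exact: class_swapK.
Qed.

End ClassModule.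

(** * The relations as identities between operators of a module *)

Section ModuleRelations.
Variables (K : fieldType) (r n : nat) (M : dmod K r n).

(** Pulls the action back to the free algebra, where the relations and the element [ge] are
    written. *)
Definition free_act (a : free_alg K n) : 'End(M) :=
  dact M (pclass (@yh_rel K r n) a).

Fact free_act_linear : linear free_act.
Proof.
move=> c a b; rewrite /free_act pclassD.
have <- : c *: pclass (@yh_rel K r n) a = pclass _ (c *: a) by exact: pclassZ.
by rewrite linearP.
Qed.
HB.instance Definition _ :=
  GRing.isLinear.Build K (free_alg K n) 'End(M) *:%R free_act free_act_linear.

Lemma free_act1 : free_act 1 = \1%VF.
Proof. exact: dact1. Qed.

Lemma free_actM a b : free_act (a * b) = (free_act a \o free_act b)%VF.
Proof. by rewrite /free_act -pclassM; apply: dactM. Qed.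

Lemma free_act_rel a b : yh_rel r a b -> free_act a = free_act b.
Proof. by move=> ab; congr (dact M _); apply/pclassP/InIdealRel. Qed.

Lemma free_actMv a b m : free_act (a * b) m = free_act a (free_act b m).
Proof.
apply: etrans (congr1 (fun g : 'End(M) => g m) (free_actM a b)) _.
exact: comp_lfunE.
Qed.

Lemma free_act_relv a b m : yh_rel r a b -> free_act a m = free_act b m.
Proof. by move/free_act_rel=> ->. Qed.

Lemma act_rel2 a b c d : yh_rel r (a * b) (c * d) ->
  forall m, free_act a (free_act b m) = free_act c (free_act d m).
Proof.
move=> ab m; apply: etrans (free_actMv c d m).
by apply: etrans (free_act_relv m ab); symmetry; apply: free_actMv.
Qed.

Local Notation T i := (dact M (dt K r i)).
Local Notation X i := (dact M (dx K r i)).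
Local Notation F k := (dact M (df K r k)).

Lemma act_tt i j m : T i (T j m) = T j (T i m).
Proof. exact: (act_rel2 (RelTT K r i j)). Qed.

Lemma act_xx i j m : X i (X j m) = X j (X i m).
Proof. exact: (act_rel2 (RelXX K r i j)). Qed.

Lemma act_tx j i m : T j (X i m) = X i (T j m).
Proof. exact: (act_rel2 (RelTX K r i j)). Qed.

Lemma act_ft k j m : F k (T j m) = T (strans k j) (F k m).
Proof. exact: (act_rel2 (RelFT K r k j)). Qed.

Lemma act_fx k j m : j != lo k -> j != hi k -> F k (X j m) = X j (F k m).
Proof. by move=> jl jh; apply: (act_rel2 (RelFX K r jl jh)). Qed.

Lemma act_ff_far (k l : 'I_n.-1) m : (k.+1 < l)%N || (l.+1 < k)%N ->
  F k (F l m) = F l (F k m).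
Proof. by move=> far; apply: (act_rel2 (RelFF K r far)). Qed.

Lemma act_ff k m : F k (F k m) = m.
Proof.
apply: etrans (etrans (free_act_relv m (RelF2 K r k)) _).
  by symmetry; apply: free_actMv.
by rewrite free_act1 id_lfunE.
Qed.

Lemma act_braid (k l : 'I_n.-1) m : l = k.+1 :> nat ->
  F k (F l (F k m)) = F l (F k (F l m)).
Proof.
move=> kl; have E a b c : free_act (a * b * c) m =
    free_act a (free_act b (free_act c m)).
  by apply: etrans (free_actMv (a * b) c m) _; apply: free_actMv.
apply: etrans (esym (E _ _ _)) (etrans _ (E _ _ _)).
exact: (free_act_relv _ (RelBraid K r kl)).
Qed.

Lemma act_fx_hi k m :
  F k (X (hi k) m) = X (lo k) (F k m) + free_act (ge K r k) m.
Proof.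
apply: etrans (esym (free_actMv _ _ _)) _.
apply: etrans (free_act_relv _ (RelFXe K r k)) _.
rewrite linearD add_lfunE; congr (_ + _); exact: free_actMv.
Qed.

Lemma act_t_eigen i c m : m != 0 -> T i m = c *: m -> c ^+ r = 1.
Proof.
move=> m0 tm; have := free_act_relv m (RelTr K r i).
have -> s : free_act (gt K i ^+ s) m = c ^+ s *: m.
  elim: s => [|s IHs]; first by rewrite !expr0 free_act1 id_lfunE scale1r.
  rewrite exprS free_actMv IHs linearZ /= exprSr -scalerA; congr (_ *: _).
  exact: tm.
rewrite free_act1 id_lfunE -[RHS]scale1r => /eqP; rewrite -subr_eq0 -scalerBl.
by rewrite scaler_eq0 (negPf m0) orbF subr_eq0 => /eqP.
Qed.

End ModuleRelations.

(** * Coordinates in a basis indexed by a finite set *)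

Section BasisSums.
Variables (K : fieldType) (S : finType) (V : vectType K).
Variables (A : {set S}) (v : S -> V).
Hypothesis v_basis : basis_of fullv [seq v w | w <- enum A].

Lemma basis_family_coord m : exists c, m = \sum_(w in A) c w *: v w.
Proof.
suff [c ->] : exists c, m = \sum_(w <- enum A) c w *: v w.
  by exists c; rewrite big_enum.
have : m \in <<[seq v w | w <- enum A]>>%VS.
  by rewrite (span_basis v_basis) memvf.
elim: (enum A) (enum_uniq A) m => [|w s IHs] /= => [_|/andP [ws us]] m.
  by rewrite span_nil memv0 => /eqP ->; exists (fun=> 0); rewrite big_nil.
rewrite span_cons => /memv_addP [_ /vlineP [k ->] [m' ms ->]].
have [c ->] := IHs us m' ms; exists (fun u => if u == w then k else c u).
rewrite big_cons eqxx; congr (_ + _); apply: eq_big_seq => u us'.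
by case: eqP us' => // ->; rewrite (negPf ws).
Qed.

Lemma basis_family_linear (rT : lmodType K) (h : S -> rT) :
  exists f : {linear V -> rT}, {in A, forall w, f (v w) = h w}.
Proof.
have [f fE] := linear_of_free [seq v w | w <- enum A] [seq h w | w <- enum A].
exists f => w wA; move: (fE (basis_free v_basis)); rewrite !size_map.
by move=> /(_ erefl); rewrite -map_comp => /eq_in_map; apply; rewrite mem_enum.
Qed.

(** A linear form equal to 1 on [v w] and 0 on the other basis vectors reads off [c w]. *)
Lemma basis_family_free c : \sum_(w in A) c w *: v w = 0 ->
  {in A, forall w, c w = 0}.
Proof.
move=> c0 w wA; have [f fv] := basis_family_linear (fun u => (u == w)%:R : K^o).
have := congr1 f c0; rewrite linear0 linear_sum (bigD1 w) //= big1 => [|u].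
  by rewrite addr0 linearZ fv // eqxx => <-; symmetry; apply: mulr1.
by case/andP=> uA uw; rewrite linearZ fv // (negPf uw); apply: mulr0.
Qed.

Lemma basis_family_neq0 w : w \in A -> v w != 0.
Proof.
move=> wA; have [f fv] := basis_family_linear (fun u => (u == w)%:R : K^o).
apply/eqP=> vw; have := fv w wA; rewrite vw linear0 eqxx => /eqP.
by rewrite eq_sym oner_eq0.
Qed.

Lemma basis_family_coord_neq0 m : m != 0 ->
  exists c w, [/\ m = \sum_(w in A) c w *: v w, w \in A & c w != 0].
Proof.
move=> m0; have [c mE] := basis_family_coord m; exists c.
have [w wA cw] : exists2 w, w \in A & c w != 0.
  apply/exists_inP; apply: contraNT m0.
  rewrite negb_exists_in => /forall_inP c0.
  by rewrite mE big1 // => w /c0 /negPn /eqP ->; rewrite scale0r.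
by exists w.
Qed.

End BasisSums.

Section DiagonalOperators.
Variables (K : fieldType) (S : finType) (V : vectType K).
Variables (A : {set S}) (v : S -> V).
Hypothesis v_basis : basis_of fullv [seq v w | w <- enum A].
Variables (g : 'End(V)) (a : S -> K).
Hypothesis g_v : {in A, forall w, g (v w) = a w *: v w}.

Lemma diagonal_sum c :
  g (\sum_(w in A) c w *: v w) = \sum_(w in A) (a w * c w) *: v w.
Proof.
rewrite linear_sum; apply: eq_bigr => w wA.
by rewrite linearZ /= g_v // scalerA mulrC.
Qed.

Lemma diagonal_eigen c b w : w \in A -> c w != 0 ->
    g (\sum_(w in A) c w *: v w) = b *: \sum_(w in A) c w *: v w ->
  a w = b.
Proof.
move=> wA cw; rewrite diagonal_sum scaler_sumr => /eqP.
rewrite -subr_eq0 -sumrB.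
under eq_bigr do rewrite scalerA -scalerBl -mulrBl.
move=> /eqP /(basis_family_free v_basis) /(_ w wA) /eqP.
by rewrite mulf_eq0 (negPf cw) orbF subr_eq0 => /eqP.
Qed.

End DiagonalOperators.

(** Isolates the formulas of [D^lambda] from the model, so that irreducibility, the weights and the
    comparison with a given irreducible module follow from the formulas alone. *)
Definition weight_basis (K : fieldType) (r n : nat) (zeta : K) (M : dmod K r n)
    (lam : {set iseq K r n}) (v : iseq K r n -> M) : Prop :=
  basis_of fullv [seq v w | w <- enum lam] /\
  forall w : iseq K r n, w \in lam ->
    [/\ forall i : 'I_n, dact M (dt K r i) (v w) = zeta ^+ ires w i *: v w,
        forall i : 'I_n, dact M (dx K r i) (v w) = ialpha w i *: v w,
        forall k : 'I_n.-1, ires w (lo k) != ires w (hi k) ->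
          dact M (df K r k) (v w) = v (swap k w) &
        forall k : 'I_n.-1, ires w (lo k) = ires w (hi k) ->
          dact M (df K r k) (v w) = v w].

(** The delta functions on [class_idx lam] are extended by zero to the other weights, since a family
    on the whole of [iseq] is asked for. *)
Lemma class_module_weight_basis (K : fieldType) (r n : nat) (zeta : K)
    (lam : {set iseq K r n}) (charK : 2%N \in [pchar K])
    (r_neq0 : r%:R != 0 :> K) (zeta_prim : r.-primitive_root zeta)
    (lam_cont : {subset lam <= Cont2 K r n})
    (lam_stable : adm_stable lam) (w0 : class_idx lam) :
  weight_basis zeta
    (M := class_module charK r_neq0 zeta_prim lam_cont lam_stable w0)
    lam (fun w => [ffun u => (val u == w)%:R]).
Proof.
have vE (u : class_idx lam) :
    [ffun u' : class_idx lam => (val u' == val u)%:R : K^o] = delta_fun K u.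
  by apply/ffunP=> u'; rewrite !ffunE.
split.
  apply: (delta_basis (g := val)) => //; first exact: val_inj.
  move=> w; apply/codomP/idP => [[u ->]|wl]; first exact: valP.
  by exists (exist [eta mem lam] w wl).
move=> w wl; rewrite -[w]/(val (exist [eta mem lam] w wl : class_idx lam)).
move: (exist _ w wl) => u {w wl}.
split=> [i|i|k kw|k kw]; rewrite vE.
- exact: class_module_t.
- exact: class_module_x.
- rewrite [LHS]class_module_f -vE; apply/ffunP=> u'.
  by rewrite !ffunE /= /cswap /admissible kw.
- rewrite [LHS]class_module_f; congr delta_fun; apply: val_inj.
  by rewrite /= /cswap /admissible kw eqxx.
Qed.

(** * Consequences of a weight basis *)

Section WeightBasisTheory.
Variables (K : closedFieldType) (r n : nat) (zeta : K) (M : dmod K r n).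
Hypothesis zeta_prim : r.-primitive_root zeta.
Variables (lam : {set iseq K r n}) (v : iseq K r n -> M).
Hypothesis v_wb : weight_basis zeta lam v.

Let v_basis := v_wb.1.
Let v_t w : w \in lam ->
  forall i, dact M (dt K r i) (v w) = zeta ^+ ires w i *: v w.
Proof. by move=> wl i; case: (v_wb.2 w wl). Qed.
Let v_x w : w \in lam ->
  forall i, dact M (dx K r i) (v w) = ialpha w i *: v w.
Proof. by move=> wl i; case: (v_wb.2 w wl). Qed.

Lemma weight_basis_in_Rep_I : in_Rep_I M.
Proof.
move=> i a; rewrite /passmx.leigenvalue /passmx.leigenspace -vpick0.
have := memv_pick (lker (dact M (dx K r i) - a *: \1%VF)).
move: (vpick _) => m; rewrite memv_ker !lfun_simp /= subr_eq0 => /eqP xm m0.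
have [c [w [mE wl cw]]] := basis_family_coord_neq0 v_basis m0.
rewrite mE in xm.
rewrite -(diagonal_eigen v_basis (fun u ul => v_x ul i) wl cw xm).
exact: ialphaP.
Qed.

(** The eigenvalues 0 and 1 make every [x_i] idempotent. *)
Lemma weight_basis_completely_splittable : completely_splittable M.
Proof.
move=> i; apply: idempotent_semisimple => m.
have [c ->] := basis_family_coord v_basis m.
rewrite !(diagonal_sum (fun u ul => v_x ul i)); apply: eq_bigr => w _.
rewrite mulrA; congr (_ * _ *: _).
by have := ialphaP w i; rewrite !inE => /orP [] /eqP ->; rewrite ?mul0r ?mulr1.
Qed.

(** Expand a weight vector in the basis: a power of [x_i - alpha_i] multiplies each coefficient by a
    power of a difference of eigenvalues, so a nonzero coefficient at [v u] forces [u = w]. *)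
Lemma weight_basis_weights w : is_weight zeta M w <-> w \in lam.
Proof.
have dE y b m : dact M (y - dscal _ _ b) m = dact M y m - b *: m.
  rewrite linearB /= add_lfunE opp_lfunE linearZ /= dact1.
  by rewrite scale_lfunE id_lfunE.
have pE y a N c : {in lam, forall u, dact M y (v u) = a u *: v u} ->
    dact M (y ^+ N) (\sum_(u in lam) c u *: v u)
      = \sum_(u in lam) (a u ^+ N * c u) *: v u.
  move=> ya; elim: N => [|N IHN].
    rewrite expr0 dact1 id_lfunE; apply: eq_bigr => u _.
    by rewrite expr0 mul1r.
  rewrite exprS dactM comp_lfunE IHN (diagonal_sum ya); apply: eq_bigr => u _.
  by rewrite exprS mulrA.
split=> [[m m0 [N0 /(_ N0 (leqnn _)) mw]]|wl].
  have [c [u [mE ul cu]]] := basis_family_coord_neq0 v_basis m0.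
  suff -> : w = u by [].
  apply: iseq_eqP => i; have [xw tw] := mw i.
    have yv : {in lam, forall u',
        dact M (dx K r i - dscal _ _ (ialpha w i)) (v u')
        = (ialpha u' i - ialpha w i) *: v u'}.
      by move=> u' ul'; rewrite dE v_x // -scalerBl.
    move: xw; rewrite mE (pE _ _ _ _ yv).
    move=> /(basis_family_free v_basis)/(_ u ul).
    move/eqP; rewrite mulf_eq0 (negPf cu) orbF expf_eq0 => /andP [_].
    by rewrite subr_eq0 => /eqP.
  apply: (prim_root_inj zeta_prim); symmetry.
  apply: (diagonal_eigen v_basis (fun u ul => v_t ul i) ul cu).
  by rewrite -mE; apply/eqP; rewrite -subr_eq0 -dE; apply/eqP.
exists (v w); first exact: (basis_family_neq0 v_basis wl).
(* The bound 1 excludes the exponent 0, at which the power is the identity; from exponent 1 on, the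
   diagonal operator kills [v w]. *)
exists 1%N => -[|N] // _ i; split.
  by rewrite exprSr dactM comp_lfunE dE v_x // subrr linear0.
by rewrite dE v_t // subrr.
Qed.

Hypothesis lam_stable : adm_stable lam.
Hypothesis lam_conn : {in lam &, forall w u, adm_equiv w u}.
Variable w0 : iseq K r n.
Hypothesis w0_lam : w0 \in lam.

(** A nonzero submodule contains a joint eigenvector of the commuting [x_i] and [t_i]. Distinct
    basis vectors have distinct weights, so it is a multiple of some [v w], and admissible [f_k]
    carry [v w] to every other basis vector. *)
Lemma weight_basis_irreducible : irreducible M.
Proof.
have vw0 := basis_family_neq0 v_basis w0_lam; split.
  rewrite lt0n dimv_eq0; apply: contra_neq vw0 => M0.
  by apply/eqP; rewrite -memv0 -M0 memvf.
move=> U sU; have [->|U0] := eqVneq U 0%VS; [by left|right].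
pose s :=
  [seq dact M (dt K r i) | i : 'I_n] ++ [seq dact M (dx K r i) | i : 'I_n].
have [|||m [mU m0 ms]] := @stable_common_eigenvector _ _ s U.
- by move=> g; rewrite mem_cat => /orP [] /imageP [i _ ->]; apply: sU.
- move=> f g; rewrite !mem_cat.
  move=> /orP [] /imageP [i _ ->] /orP [] /imageP [j _ ->] m.
  + exact: act_tt.
  + exact: act_tx.
  + by symmetry; apply: act_tx.
  + exact: act_xx.
- exact: U0.
have [c [w [mE wl cw]]] := basis_family_coord_neq0 v_basis m0.
have mw : m = c w *: v w.
  rewrite mE (bigD1 w) //= big1 ?addr0 // => u /andP [ul uw].
  have [->|cu] := eqVneq (c u) 0; first exact: scale0r.
  case/eqP: uw; apply: iseq_eqP => i.
    have [|a] := ms (dact M (dx K r i)).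
      by rewrite mem_cat; apply/orP; right; apply: image_f.
    rewrite mE => xm.
    have E := diagonal_eigen v_basis (fun u ul => v_x ul i).
    by rewrite (E _ _ _ ul cu xm) (E _ _ _ wl cw xm).
  have [|a] := ms (dact M (dt K r i)).
    by rewrite mem_cat; apply/orP; left; apply: image_f.
  rewrite mE => tm; apply: (prim_root_inj zeta_prim).
  have E := diagonal_eigen v_basis (fun u ul => v_t ul i).
  by rewrite (E _ _ _ ul cu tm) (E _ _ _ wl cw tm).
have vwU : v w \in U.
  by rewrite -[v w](scalerK cw) -mw memvZ.
have vU u : u \in lam -> v u \in U.
  move=> ul; have /connectP [p pw ->] := lam_conn wl ul.
  elim: p w wl vwU pw {mE mw cw ul} => [|u' p IHp] w' wl' vwU' //=.
  case/andP=> /existsP [k /andP [kw /eqP ->]] pw; apply: IHp pw.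
    exact: lam_stable.
  have [_ _ fv _] := v_wb.2 w' wl'; rewrite -fv //.
  exact/(subvP (sU _))/memv_img.
apply/eqP; rewrite eqEsubv subvf /=; apply/subvP=> m' _.
have [c' ->] := basis_family_coord v_basis m'.
by apply: rpred_sum => u ul; apply/memvZ/vU.
Qed.

End WeightBasisTheory.

(** Asks for genuine eigenvectors and admits the zero vector; nonvanishing is stated apart. *)
Definition weight_vector (K : fieldType) (r n : nat) (zeta : K) (M : dmod K r n)
    (w : iseq K r n) (m : M) : Prop :=
  (forall i, dact M (dx K r i) m = ialpha w i *: m) /\
  (forall i, dact M (dt K r i) m = zeta ^+ ires w i *: m).

(** * How [f_k] moves weight vectors *)

Section WeightVectors.
Variables (K : fieldType) (r n : nat) (zeta : K) (M : dmod K r n).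
Hypotheses (charK : 2%N \in [pchar K]) (r_neq0 : r%:R != 0 :> K).
Hypothesis zeta_prim : r.-primitive_root zeta.
Hypothesis M_split : completely_splittable M.
Implicit Types (w : iseq K r n) (m : M) (k l : 'I_n.-1).

Local Notation T i := (dact M (dt K r i)).
Local Notation X i := (dact M (dx K r i)).
Local Notation F k := (dact M (df K r k)).

Lemma weight_vector0 w : weight_vector zeta w (0 : M).
Proof. by split=> i; rewrite linear0 scaler0. Qed.

Lemma ires_strans k w i : ires w (lo k) = ires w (hi k) ->
  ires w (strans k i) = ires w i.
Proof. by move=> E; rewrite -ires_cswap /cswap /admissible E eqxx. Qed.

Section Reflection.
Variables (w : iseq K r n) (m : M) (k : 'I_n.-1).
Hypothesis mw : weight_vector zeta w m.

Lemma t_reflect i : T i (F k m) = zeta ^+ ires w (strans k i) *: F k m.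
Proof. by rewrite -{1}(stransK k i) -act_ft mw.2 linearZ. Qed.

Lemma x_lo_reflect :
  X (lo k) (F k m) =
  ialpha w (hi k) *: F k m - (ires w (lo k) == ires w (hi k))%:R *: m.
Proof.
rewrite -(ge_eigen r_neq0 zeta_prim (free_act1 M) (@free_actM _ _ _ M)
  (mw.2 (lo k)) (mw.2 (hi k))).
by apply/eqP; rewrite eq_sym subr_eq -act_fx_hi mw.1 linearZ.
Qed.

(** The relation for [f_k x_(k+1)] is taken at [f_k m], and [f_k] is applied once more, using that
    it squares to 1; [e_k] sees the same two residues in exchanged order. *)
Lemma x_hi_reflect :
  X (hi k) (F k m) =
  ialpha w (lo k) *: F k m + (ires w (lo k) == ires w (hi k))%:R *: m.
Proof.
have tlo := t_reflect (lo k); have thi := t_reflect (hi k).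
rewrite strans_lo in tlo; rewrite strans_hi in thi.
rewrite -[LHS](act_ff k) act_fx_hi act_ff mw.1.
rewrite (ge_eigen r_neq0 zeta_prim (free_act1 M) (@free_actM _ _ _ M) tlo thi).
by rewrite linearD !linearZ /= act_ff eq_sym.
Qed.

Lemma x_reflect i : i != lo k -> i != hi k ->
  X i (F k m) = ialpha w i *: F k m.
Proof. by move=> il ih; rewrite -act_fx // mw.1 linearZ. Qed.

Lemma weight_vector_swap :
  admissible k w -> weight_vector zeta (swap k w) (F k m).
Proof.
move=> /negPf kw; split=> i; last by rewrite t_reflect ires_swap.
have [->|il] := eqVneq i (lo k).
  by rewrite x_lo_reflect kw scale0r subr0 ialpha_swap strans_lo.
have [->|ih] := eqVneq i (hi k).
  by rewrite x_hi_reflect kw scale0r addr0 ialpha_swap strans_hi.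
by rewrite x_reflect // ialpha_swap strans_id.
Qed.

(** Both reflection formulas carry an extra term, [- m] or [m]; since [alpha_(k+1) = alpha_k + 1],
    subtracting [m] from [f_k m] absorbs it. *)
Lemma weight_vector_reflectB :
  w \in Cont2 K r n -> ires w (lo k) = ires w (hi k) ->
  weight_vector zeta (swap k w) (F k m - m).
Proof.
move=> wC kw; have ak := Cont2_ialpha charK wC kw.
split=> i; rewrite linearB /=; last first.
  by rewrite t_reflect mw.2 ires_swap scalerBr ires_strans.
have [->|il] := eqVneq i (lo k).
  rewrite x_lo_reflect kw eqxx scale1r mw.1 ialpha_swap strans_lo ak scalerBr.
  by rewrite -addrA -opprD; congr (_ - _); rewrite scalerDl scale1r addrC.
have [->|ih] := eqVneq i (hi k).
  rewrite x_hi_reflect kw eqxx mw.1 ialpha_swap strans_hi ak scalerBr.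
  rewrite -addrA; congr (_ + _); rewrite -scalerBl -scaleNr; congr (_ *: _).
  by rewrite opprD addrCA subrr addr0.
by rewrite x_reflect // mw.1 ialpha_swap strans_id // scalerBr.
Qed.

End Reflection.

(** If both residues and both eigenvalues at [k] agreed, [x_k - alpha_k] would send [f_k m] to
    [- m], an eigenvector for the same [alpha_k]: a Jordan block of size two, which semisimplicity
    forbids. *)
Lemma weight_in_Cont2 w m :
  m != 0 -> weight_vector zeta w m -> w \in Cont2 K r n.
Proof.
move=> m0 mw; rewrite inE; apply/forallP=> k; apply/implyP=> /eqP kw.
apply: contra_neq m0 => ak; have := x_lo_reflect k mw.
rewrite kw eqxx scale1r -ak => xf.
have dxf : X (lo k) (F k m) - ialpha w (lo k) *: F k m = - m.
  by rewrite xf addrAC subrr add0r.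
have ss : semisimple_end (X (lo k)) by apply: M_split.
have := semisimple_eigenvector (m := F k m) (a := ialpha w (lo k)) ss.
rewrite dxf linearN /= mw.1 scalerN => /(_ erefl) E.
by move: dxf; rewrite E subrr => /eqP; rewrite eq_sym oppr_eq0 => /eqP.
Qed.

Lemma swap_weight w m k : weight_vector zeta w m -> m != 0 -> admissible k w ->
  weight_vector zeta (swap k w) (F k m) /\ F k m != 0.
Proof.
move=> mw m0 kw; split; first exact: weight_vector_swap.
by apply: contra_neq m0 => fm; rewrite -(act_ff k m) fm linear0.
Qed.

Definition sorted_res w := forall k, (ires w (lo k) <= ires w (hi k))%N.

(** Each descent of the residues is an admissible position, and swapping there lowers
    [weighted_res]. *)
Lemma sorted_weight w m : weight_vector zeta w m -> m != 0 ->
  exists w' m', [/\ sorted_res w', weight_vector zeta w' m' & m' != 0].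
Proof.
have [N] := ubnP (weighted_res w); elim: N w m => // N IHN w m.
rewrite ltnS => wN mw m0.
have [/forallP srt|] :=
  boolP [forall k : 'I_n.-1, (ires w (lo k) <= ires w (hi k))%N].
  by exists w, m.
rewrite negb_forall => /existsP [k]; rewrite -ltnNge => kw.
have [|mw' m0'] := swap_weight (k := k) mw m0.
  by rewrite /admissible -val_eqE gtn_eqF.
apply: IHN mw' m0'; exact: leq_trans (weighted_res_swap kw) wN.
Qed.

(* Induction on the number [N] of positions treated. If [f_k m <> m], then [m]
   is replaced by [f_k m - m]; an earlier [f_l] with [l = k - 1] cannot have
   [j_l = j_k], since [s_k alpha] would then repeat an entry at [l] and [k]. *)
Lemma fixed_sorted_weight w m :
    sorted_res w -> weight_vector zeta w m -> m != 0 ->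
  exists w' m', [/\ sorted_res w', weight_vector zeta w' m', m' != 0 &
    forall k, ires w' (lo k) = ires w' (hi k) -> F k m' = m'].
Proof.
move=> sw mw m0.
suff /(_ n) [w' [m' [sw' mw' m0' fix']]] : forall N, exists w' m',
    [/\ sorted_res w', weight_vector zeta w' m', m' != 0 &
    forall k, (k < N)%N -> ires w' (lo k) = ires w' (hi k) -> F k m' = m'].
  exists w', m'; split=> // k; apply: fix'.
  exact: leq_trans (ltn_ord k) (leq_pred n).
elim=> [|N [w' [m' [sw' mw' m0' fix']]]]; first by exists w, m.
have old k : (k < N.+1)%N -> k != N :> nat -> (k < N)%N by lia.
have [Nn|Nn] := ltnP N n.-1; last first.
  exists w', m'; split=> // k; rewrite ltnS => kN; apply: fix'.
  exact: leq_trans (ltn_ord k) Nn.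
pose k := Ordinal Nn.
have [fk|fk] := eqVneq (F k m') m'.
  exists w', m'; split=> // l lN lw.
  have [lk|lk] := eqVneq l k; first by rewrite lk.
  apply: fix' lw; apply: old lN _.
  by apply: contra_neq lk => lN'; apply: val_inj.
have [kw|kw] := eqVneq (ires w' (lo k)) (ires w' (hi k)); last first.
  exists w', m'; split=> // l lN lw; apply: (fix' l _ lw); apply: old lN _.
  apply: contraNneq kw => lk; have <- : l = k by apply: val_inj.
  by apply/eqP.
have wC := weight_in_Cont2 m0' mw'.
have u0 : F k m' - m' != 0 by rewrite subr_eq0.
have uw := weight_vector_reflectB mw' wC kw.
have uC := weight_in_Cont2 u0 uw.
have resE i : ires (swap k w') i = ires w' i by rewrite ires_swap ires_strans.
exists (swap k w'), (F k m' - m'); split=> // [l|l lN]; rewrite !resE => // lw.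
have [->|lk] := eqVneq l k.
  (* In characteristic 2, [f_k (f_k m - m) = m - f_k m] is [f_k m - m] again. *)
  have NE (u : M) : - u = u.
    by rewrite -scaleN1r (oppr_pchar2 charK) scale1r.
  by rewrite linearB /= act_ff -[RHS]NE opprB.
have lN' : (l < N)%N.
  apply: old lN _.
  by apply: contra_neq lk => lN'; apply: val_inj.
have [far|near] := ltnP l.+1 N.
  have kl : (k.+1 < l)%N || (l.+1 < k)%N by apply/orP; right.
  by rewrite linearB /= -(act_ff_far _ kl) fix'.
have kl : k = l.+1 :> nat by apply/eqP; rewrite eqn_leq near.
have E := hi_lo kl.
have a1 := Cont2_ialpha charK wC lw; have a2 := Cont2_ialpha charK wC kw.
have := Cont2_ialpha charK uC (k := l).
rewrite !resE => /(_ lw); rewrite -E !ialpha_swap strans_lo.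
have -> : strans k (lo l) = lo l by rewrite strans_id // -val_eqE ltn_eqF.
rewrite -a1 a2 -E => /eqP; rewrite -subr_eq0 addrAC subrr add0r oner_eq0.
by [].
Qed.

End WeightVectors.

(** * Extension of a sorted weight vector to all weights *)

Section SortedExtension.
Variables (K : fieldType) (r n : nat) (zeta : K) (M : dmod K r n).
Hypotheses (r_neq0 : r%:R != 0 :> K) (zeta_prim : r.-primitive_root zeta).
Variables (w0 : iseq K r n) (m0 : M).
Hypotheses (w0_sorted : sorted_res w0) (m0_w0 : weight_vector zeta w0 m0).
Hypothesis m0_fixed :
  forall k, ires w0 (lo k) = ires w0 (hi k) -> dact M (df K r k) m0 = m0.
Implicit Types (w : iseq K r n) (k l : 'I_n.-1).

Local Notation F k := (dact M (df K r k)).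

Definition descent w k := (ires w (hi k) < ires w (lo k))%N.

(** [N] bounds the number of sorting steps. [pick] chooses some descent; by [ext_vec_descent] any
    other gives the same vector. *)
Fixpoint sort_ext (N : nat) (w : iseq K r n) : M :=
  if N is N'.+1 then
    if [pick k | descent w k] is Some k then F k (sort_ext N' (swap k w))
    else if w == w0 then m0 else 0
  else if w == w0 then m0 else 0.

(* [ext_vec w] is [0] when sorting [w] does not lead to [w0], which makes the
   relations below hold for all [w]. *)
Definition ext_vec w := sort_ext (weighted_res w) w.

Lemma sort_ext_bound N1 N2 w : (weighted_res w <= N1)%N ->
  (weighted_res w <= N2)%N -> sort_ext N1 w = sort_ext N2 w.
Proof.
elim: N1 N2 w => [|N1 IH] [|N2] w //= le1 le2; case: pickP => // k dk;
  have := weighted_res_swap dk => lt.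
- by move: (leq_trans lt le1).
- by move: (leq_trans lt le2).
- by congr (F k _); apply: IH; rewrite -ltnS; apply: leq_trans lt _.
Qed.

Lemma ext_vec_sorted w : (forall k, ~~ descent w k) ->
  ext_vec w = if w == w0 then m0 else 0.
Proof.
rewrite /ext_vec; case: (weighted_res w) => [|N] //= nd.
by case: pickP => // k; rewrite (negPf (nd k)).
Qed.

Lemma ext_vec_step w : (exists k, descent w k) ->
  exists2 k, descent w k & ext_vec w = F k (ext_vec (swap k w)).
Proof.
case=> k0 dk0; rewrite /ext_vec.
have := weighted_res_swap dk0; case E: (weighted_res w) => [|N] // _ /=.
case: pickP => [k dk|/(_ k0)]; last by rewrite dk0.
exists k => //; congr (F k _); apply: sort_ext_bound => //.
by rewrite -ltnS -E; apply: weighted_res_swap.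
Qed.

Lemma descent_far w k l : (k.+1 < l)%N || (l.+1 < k)%N ->
  descent (swap l w) k = descent w k.
Proof. by move=> far; rewrite /descent !(ires_swap_far w far). Qed.

(** Local confluence: two descents of [w] lead to the same vector, by commutation if they are far
    apart and by the braid relation if adjacent. The induction on [weighted_res] covers the weights
    reached after the first step. *)
Lemma ext_vec_descent w k : descent w k -> ext_vec w = F k (ext_vec (swap k w)).
Proof.
have [N] := ubnP (weighted_res w); elim: N w k => // N IHN w k.
rewrite ltnS => wN dk.
have IH u l : descent w l -> u = swap l w -> forall l', descent u l' ->
    ext_vec u = F l' (ext_vec (swap l' u)).
  move=> dl -> l' dl'; apply: IHN dl'.
  exact: leq_trans (weighted_res_swap dl) wN.
have IH2 l l' u : descent w l -> descent (swap l w) l' ->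
    u = swap l' (swap l w) -> forall l'', descent u l'' ->
    ext_vec u = F l'' (ext_vec (swap l'' u)).
  move=> dl dl' -> l'' dl''; apply: IHN dl''.
  apply: leq_trans (weighted_res_swap dl') _; apply: ltnW.
  exact: leq_trans (weighted_res_swap dl) wN.
have far_eq (p q : 'I_n.-1) : (p.+1 < q)%N || (q.+1 < p)%N ->
    descent w p -> descent w q ->
    F p (ext_vec (swap p w)) = F q (ext_vec (swap q w)).
  move=> far dp dq; have far' : (q.+1 < p)%N || (p.+1 < q)%N by rewrite orbC.
  rewrite (IH _ _ dp erefl q) ?descent_far //.
  rewrite (IH _ _ dq erefl p) ?descent_far //.
  by rewrite act_ff_far // swap_far.
(* Adjacent descents mean three strictly decreasing residues, so each path has two further descents
   and both arrive at the same weight. *)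
have next_eq (p q : 'I_n.-1) : q = p.+1 :> nat -> descent w p -> descent w q ->
    F p (ext_vec (swap p w)) = F q (ext_vec (swap q w)).
  move=> pq dp dq; have E := hi_lo pq.
  have NP (u : iseq K r n) := ires_swap_next u pq.
  have [a1 a2 a3 a4] := NP w; move: (dp) (dq); rewrite /descent E => lt1 lt2.
  have d1 : descent (swap p w) q.
    by rewrite /descent a3 a4; apply: ltn_trans lt1.
  have d2 : descent (swap q w) p.
    by rewrite /descent a1 a2; apply: ltn_trans lt1.
  have [b1 b2 _ _] := NP (swap p w); have [_ _ c3 c4] := NP (swap q w).
  have d1' : descent (swap q (swap p w)) p.
    by rewrite /descent b1 b2 a4 ires_swap_lo.
  have d2' : descent (swap p (swap q w)) q.
    by rewrite /descent c3 c4 a1 ires_swap_hi E.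
  rewrite (IH _ _ dp erefl q d1) (IH2 _ _ _ dp d1 erefl p d1').
  rewrite (IH _ _ dq erefl p d2) (IH2 _ _ _ dq d2 erefl q d2').
  by rewrite act_braid // swap_braid.
have [|l dl ->] := ext_vec_step (w := w); first by exists k.
have [->//|lk] := eqVneq l k.
have {}lk : nat_of_ord l != k by [].
case: (ltngtP l k) lk => // lt _.
- have [far|near] := ltnP l.+1 k; first by apply: far_eq => //; rewrite far.
  by apply: next_eq => //; apply/eqP; rewrite eqn_leq near.
- have [far|near] := ltnP k.+1 l.
    by apply: far_eq => //; rewrite far orbT.
  by symmetry; apply: next_eq => //; apply/eqP; rewrite eqn_leq near.
Qed.

Lemma descentPn w : (exists k, descent w k) \/ (forall k, ~~ descent w k).
Proof.
have [/existsP|] := boolP [exists k, descent w k]; first by left.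
by rewrite negb_exists => /forallP; right.
Qed.

Lemma descent_admissible w k : descent w k -> admissible k w.
Proof. by move=> dk; rewrite /admissible -val_eqE gtn_eqF. Qed.

Lemma ext_vec_weight w : weight_vector zeta w (ext_vec w).
Proof.
have [N] := ubnP (weighted_res w); elim: N w => // N IHN w.
rewrite ltnS => wN; have [[k dk]|nd] := descentPn w.
  rewrite (ext_vec_descent dk) -{1}(swapK k w).
  apply: (weight_vector_swap r_neq0 zeta_prim).
    apply: IHN; exact: leq_trans (weighted_res_swap dk) wN.
  by rewrite admissible_swap descent_admissible.
by rewrite ext_vec_sorted //; case: eqP => [->|_] //; apply: weight_vector0.
Qed.

Lemma ext_vec_base : ext_vec w0 = m0.
Proof. by rewrite ext_vec_sorted ?eqxx // => k; rewrite /descent -leqNgt. Qed.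

(** Exactly one of [w] and [swap k w] has a descent at [k]; if it is [w], that [f_k] squares to 1 is
    used. *)
Lemma ext_vec_swap w k : admissible k w -> F k (ext_vec w) = ext_vec (swap k w).
Proof.
rewrite /admissible -val_eqE neq_ltn => /orP [lt|gt].
  have dk : descent (swap k w) k by rewrite /descent ires_swap_lo ires_swap_hi.
  by rewrite (ext_vec_descent dk) swapK.
by rewrite (ext_vec_descent gt) act_ff.
Qed.

(** Induction along a descent [l] of [w]. A distant [f_l] commutes with [f_k]. If [l] is adjacent,
    [k] is a descent of [swap l w], and the braid relation turns [f_k f_l f_k] into [f_l f_k f_l],
    whose rightmost factor fixes the vector by induction. *)
Lemma ext_vec_fixed w k : ires w (lo k) = ires w (hi k) ->
  F k (ext_vec w) = ext_vec w.
Proof.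
have [N] := ubnP (weighted_res w); elim: N w k => // N IHN w k.
rewrite ltnS => wN kw; have [[l dl]|nd] := descentPn w; last first.
  rewrite ext_vec_sorted //; case: eqP kw => [->|_ _]; first exact: m0_fixed.
  by rewrite linear0.
have lt1 := weighted_res_swap dl.
rewrite (ext_vec_descent dl).
have far_case : (k.+1 < l)%N || (l.+1 < k)%N ->
    F k (F l (ext_vec (swap l w))) = F l (ext_vec (swap l w)).
  move=> far; rewrite act_ff_far // IHN //; first exact: leq_trans wN.
  by rewrite !(ires_swap_far w far).
case: (ltngtP l k) => [lt|gt|E].
- have [far|near] := ltnP l.+1 k; first by apply: far_case; rewrite far orbT.
  have lk : k = l.+1 :> nat by apply/eqP; rewrite eqn_leq near.
  have E := hi_lo lk; have [a1 a2 a3 a4] := ires_swap_next w lk.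
  have dk : descent (swap l w) k.
    by rewrite /descent a3 a4 -kw E; apply: dl.
  have lt2 := weighted_res_swap dk.
  have [b1 b2 _ _] := ires_swap_next (swap l w) lk.
  rewrite (ext_vec_descent dk) -(act_braid _ lk) (IHN (swap k (swap l w)) l) //.
    by apply: leq_trans lt2 _; apply: ltnW; apply: leq_trans wN.
  by rewrite b1 b2 a4 -kw E ires_swap_lo.
- have [far|near] := ltnP k.+1 l; first by apply: far_case; rewrite far.
  have kl : l = k.+1 :> nat by apply/eqP; rewrite eqn_leq near.
  have E := hi_lo kl; have [a1 a2 a3 a4] := ires_swap_next w kl.
  have dk : descent (swap l w) k.
    by rewrite /descent a1 a2 kw -E; apply: dl.
  have lt2 := weighted_res_swap dk.
  have [_ _ b3 b4] := ires_swap_next (swap l w) kl.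
  rewrite (ext_vec_descent dk) (act_braid _ kl) (IHN (swap k (swap l w)) l) //.
    by apply: leq_trans lt2 _; apply: ltnW; apply: leq_trans wN.
  by rewrite b3 b4 a1 ires_swap_hi kw E.
- by move: dl; rewrite /descent (_ : l = k) ?kw ?ltnn //; apply: val_inj.
Qed.

End SortedExtension.

(** * Intertwining maps and Schur's lemma *)

Section Homomorphisms.
Variables (K : fieldType) (r n : nat) (M N : dmod K r n).

Lemma intertwiner_gens (f : {linear M -> N}) :
    (forall i m, f (dact M (dt K r i) m) = dact N (dt K r i) (f m)) ->
    (forall i m, f (dact M (dx K r i) m) = dact N (dx K r i) (f m)) ->
    (forall k m, f (dact M (df K r k) m) = dact N (df K r k) (f m)) ->
  forall a m, f (dact M a m) = dact N a (f m).
Proof.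
move=> ft fx ff; elim/dyh_ind => [m|a b fa fb m|a b fa fb m|c a fa m|i|i|k] //.
- by rewrite !dact1 !id_lfunE.
- by rewrite !linearD !add_lfunE linearD fa fb.
- by rewrite !dactM !comp_lfunE fa fb.
- by rewrite !linearZ !scale_lfunE linearZ fa.
Qed.

Lemma schur_iso (f : {linear M -> N}) : irreducible M -> irreducible N ->
    (forall a m, f (dact M a m) = dact N a (f m)) -> (exists m, f m != 0) ->
  dmod_iso N M.
Proof.
move=> [_ irrM] [_ irrN] fa [m0 fm0]; pose g := linfun f.
have gE m : g m = f m by rewrite lfunE.
have g_inj : lker g = 0%VS.
  have [|//|kF] := irrM (lker g).
    move=> a; apply/subvP=> _ /memv_imgP [m mk ->]; move: mk.
    by rewrite !memv_ker !gE fa => /eqP ->; rewrite linear0.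
  by case/eqP: fm0; apply/eqP; rewrite -gE -memv_ker kF memvf.
have g_surj : limg g = fullv.
  have [|I0|//] := irrN (limg g).
    move=> a; apply/subvP=> _ /memv_imgP [_ /memv_imgP [m _ ->] ->].
    by rewrite gE -fa -gE memv_img ?memvf.
  by case/eqP: fm0; apply/eqP; rewrite -gE -memv0 -I0 memv_img ?memvf.
have gK : cancel g g^-1%VF by apply: lker0_lfunK; rewrite g_inj.
have gVK : cancel g^-1%VF g.
  by move=> m; apply: limg_lfunVK; rewrite g_surj memvf.
exists g^-1%VF; split; first by exists g.
by move=> a m; apply: (can_inj gK); rewrite gVK gE fa -gE gVK.
Qed.

End Homomorphisms.

(** The commuting [x_i] and [t_i] have a joint eigenvector. The eigenvalues of the [x_i] lie in [I]
    by [in_Rep_I], and those of the [t_i] are [r]-th roots of unity, hence powers of [zeta]. *)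
Lemma exists_weight_vector (K : closedFieldType) (r n : nat) (zeta : K)
    (M : dmod K r n) :
    r.-primitive_root zeta -> in_Rep_I M -> (0 < \dim {:M})%N ->
  exists w (m : M), m != 0 /\ weight_vector zeta w m.
Proof.
move=> zeta_prim repM dimM.
pose s :=
  [seq dact M (dt K r i) | i : 'I_n] ++ [seq dact M (dx K r i) | i : 'I_n].
have [|||m [_ m0 ms]] := @stable_common_eigenvector _ _ s fullv.
- by move=> g _; apply: subvf.
- move=> f g; rewrite !mem_cat.
  move=> /orP [] /imageP [i _ ->] /orP [] /imageP [j _ ->] m.
  + exact: act_tt.
  + exact: act_tx.
  + by symmetry; apply: act_tx.
  + exact: act_xx.
- by rewrite -dimv_eq0 -lt0n.
have xm i : exists a : seq_sub (I_vals K), dact M (dx K r i) m = ssval a *: m.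
  have [|a xa] := ms (dact M (dx K r i)).
    by rewrite mem_cat; apply/orP; right; apply: image_f.
  have aI : a \in I_vals K.
    apply: (repM i); rewrite /passmx.leigenvalue; apply: contraNneq m0 => l0.
    by rewrite -memv0 -l0 memv_ker !lfun_simp /= xa subrr.
  by exists (SeqSub aI).
have tm i : exists j : 'I_r, dact M (dt K r i) m = zeta ^+ j *: m.
  have [|c tc] := ms (dact M (dt K r i)).
    by rewrite mem_cat; apply/orP; left; apply: image_f.
  have [j cj] := prim_rootP zeta_prim (act_t_eigen m0 tc).
  by exists j; rewrite tc cj.
have [a aE] := fin_all_exists xm; have [j jE] := fin_all_exists tm.
exists ([ffun i => a i], [ffun i => j i]), m; split=> //.
by split=> i; rewrite /ialpha /ires /= ffunE.
Qed.

(** * Equivalence classes of weights *)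

Section ClassOfWeight.
Variables (K : fieldType) (r n : nat).
Implicit Types w u : iseq K r n.

Lemma adm_equiv_sym w u : adm_equiv w u = adm_equiv u w.
Proof.
apply: sym_connect_sym => {}w {}u; rewrite /adm_step /=.
suff H w' u' : [exists k, admissible k w' && (u' == swap k w')] ->
    [exists k, admissible k u' && (w' == swap k u')] by apply/idP/idP; apply: H.
case/existsP=> k /andP [kw /eqP ->]; apply/existsP; exists k.
by rewrite admissible_swap kw swapK eqxx.
Qed.

Lemma adm_equiv_step w k : admissible k w -> adm_equiv w (swap k w).
Proof. by move=> kw; apply/connect1/existsP; exists k; rewrite kw eqxx. Qed.

Lemma adm_equiv_ind (P : iseq K r n -> Prop) w :
    P w -> (forall u k, P u -> admissible k u -> P (swap k u)) ->
  forall u, adm_equiv w u -> P u.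
Proof.
move=> Pw Ps u /connectP [p]; elim: p w Pw => [|x p IHp] w Pw /=.
  by move=> _ ->.
by case/andP=> /existsP [k /andP [kw /eqP ->]]; apply/IHp/Ps.
Qed.

Lemma Cont2_quotientP (lam : {set iseq K r n}) : lam \in Cont2_quotient K r n ->
  [/\ {subset lam <= Cont2 K r n}, exists w, w \in lam &
      {in lam &, forall w u, adm_equiv w u}].
Proof.
case/imsetP=> w wC ->; split=> [u|| u u'].
- by rewrite inE => /andP [].
- by exists w; rewrite inE wC /adm_equiv connect0.
rewrite !inE => /andP [_ wu] /andP [_ wu'].
by apply: connect_trans wu'; rewrite -/(adm_equiv _ _) adm_equiv_sym.
Qed.

End ClassOfWeight.

(** The class is that of the sorted weight [w] carrying the fixed vector [m]. Quantifying over all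
    [D] with a weight basis for it leaves the choice of the model to the theorem. *)
Lemma irreducible_iso_weight_basis (K : closedFieldType) (r n : nat) (zeta : K)
    (M : dmod K r n) :
    2%N \in [pchar K] -> r%:R != 0 :> K -> r.-primitive_root zeta ->
    in_Rep_I M -> irreducible M -> completely_splittable M ->
  exists lam : {set iseq K r n},
    [/\ lam \in Cont2_quotient K r n, adm_stable lam &
      forall (D : dmod K r n) (v : iseq K r n -> D),
        irreducible D -> weight_basis zeta lam v -> dmod_iso M D].
Proof.
move=> charK r0 zp repM irrM splM.
have [w' [m' [m'0 w'm']]] := exists_weight_vector zp repM irrM.1.
have [w'' [m'' [srt'' wm'' m''0]]] := sorted_weight r0 zp w'm' m'0.
have [w [m [srt wm m0 fixm]]] :=
  fixed_sorted_weight charK r0 zp splM srt'' wm'' m''0.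
pose isw (u : iseq K r n) := exists2 m' : M, m' != 0 & weight_vector zeta u m'.
have iswC u : isw u -> u \in Cont2 K r n.
  by case=> mu mu0 /(weight_in_Cont2 r0 zp splM mu0).
(* As [f_k] is invertible, the whole orbit of [w] consists of weights of [M]; all of them lie in
   [Cont2], which makes the class stable. *)
have equiv_isw u : adm_equiv w u -> isw u.
  apply: adm_equiv_ind; first by exists m.
  move=> {}u k [mu mu0 wmu] ku.
  by have [] := swap_weight r0 zp wmu mu0 ku; exists (dact M (df K r k) mu).
exists [set u in Cont2 K r n | adm_equiv w u]; split.
- by apply: imset_f; apply: iswC; exists m.
- move=> u k; rewrite !inE => /andP [_ wu] ku.
  have wsu := connect_trans wu (adm_equiv_step ku).
  by have := iswC _ (equiv_isw _ wsu); rewrite inE => ->.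
move=> D v irrD vb; pose U := @ext_vec K r n M w m.
have [f fv] := basis_family_linear vb.1 U.
have wl : w \in [set u in Cont2 K r n | adm_equiv w u].
  by rewrite inE /adm_equiv connect0 andbT; apply: iswC; exists m.
apply: (schur_iso (f := f)) => //; last first.
  by exists (v w); rewrite fv // /U ext_vec_base.
have gen_f (a : 'End(D)) (b : 'End(M)) :
    {in [set u in Cont2 K r n | adm_equiv w u],
      forall u, f (a (v u)) = b (U u)} ->
    forall d, f (a d) = b (f d).
  move=> ab d; have [c ->] := basis_family_coord vb.1 d.
  rewrite !linear_sum; apply: eq_bigr => u ul.
  by rewrite !linearZ /= ab // fv.
have Uw u : weight_vector zeta u (U u) by apply: ext_vec_weight.
apply: intertwiner_gens => i d; apply: gen_f => u ul;
  have [vt vx va ve] := vb.2 u ul.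
- by rewrite vt linearZ fv // (Uw u).2.
- by rewrite vx linearZ fv // (Uw u).1.
have [kw|kw] := eqVneq (ires u (lo i)) (ires u (hi i)).
  by rewrite ve // fv // ext_vec_fixed.
rewrite va // fv ?ext_vec_swap //.
move: ul; rewrite !inE => /andP [_ wu].
have wsu := connect_trans wu (adm_equiv_step kw).
by have := iswC _ (equiv_isw _ wsu); rewrite inE => ->.
Qed.

(** * Zero module and assembly of the theorem *)

Section ZeroModule.
Variables (K : fieldType) (r n : nat).
Local Notation zero_act := (\0 : dyh K r n -> 'End('rV[K]_0)).

Fact zero_act1 : zero_act 1 = \1%VF.
Proof. by apply/lfunP=> m; rewrite [LHS]thinmx0 [RHS]thinmx0. Qed.

Fact zero_actM a b : zero_act (a * b) = (zero_act a \o zero_act b)%VF.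
Proof. by apply/lfunP=> m; rewrite [LHS]thinmx0 [RHS]thinmx0. Qed.

(** Default value of [D] at the sets that are not stable classes, where nothing is required. *)
Definition zero_dmod : dmod K r n := DMod zero_act1 zero_actM.

End ZeroModule.

(* The hypothesis adm_stable lam says that v (swap k w) is again one of the
   basis vectors whenever s_k is admissible for w in lam. *)
Theorem theorem5p7 (K : closedFieldType) (r n : nat) (zeta : K)
    (charK : 2%N \in [pchar K]) (r_ge1 : (1 <= r)%N) (r_odd : ~~ (2 %| r)%N)
    (n_ge1 : (1 <= n)%N) (zeta_prim : r.-primitive_root zeta) :
  exists D : {set iseq K r n} -> dmod K r n,
    (forall lam : {set iseq K r n},
       lam \in Cont2_quotient K r n -> adm_stable lam ->
       [/\ in_Rep_I (D lam), irreducible (D lam),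
           completely_splittable (D lam),
           (forall w : iseq K r n, is_weight zeta (D lam) w <-> w \in lam) &
           exists v : iseq K r n -> D lam,
             basis_of fullv [seq v w | w <- enum lam] /\
             forall w : iseq K r n, w \in lam ->
               [/\ forall i : 'I_n,
                     dact (D lam) (dt K r i) (v w) = zeta ^+ ires w i *: v w,
                   forall i : 'I_n,
                     dact (D lam) (dx K r i) (v w) = ialpha w i *: v w,
                   forall k : 'I_n.-1, ires w (lo k) != ires w (hi k) ->
                     dact (D lam) (df K r k) (v w) = v (swap k w) &
                   forall k : 'I_n.-1, ires w (lo k) = ires w (hi k) ->
                     dact (D lam) (df K r k) (v w) = v w]]) /\
    (forall M : dmod K r n,
       in_Rep_I M -> irreducible M -> completely_splittable M ->
       exists lam : {set iseq K r n},
         [/\ lam \in Cont2_quotient K r n, adm_stable lam &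
             dmod_iso M (D lam)]).
Proof.
have r0 : r%:R != 0 :> K by rewrite -(dvdn_pcharf charK).
have [D D_basis] : exists D : {set iseq K r n} -> dmod K r n, forall lam,
    lam \in Cont2_quotient K r n -> adm_stable lam ->
    exists v : iseq K r n -> D lam, weight_basis zeta lam v.
  (* The hypotheses on [lam] go inside the existential, so that choice applies to all [lam] at
     once. *)
  suff /choice [D DP] : forall lam, exists D : dmod K r n,
      lam \in Cont2_quotient K r n -> adm_stable lam ->
      exists v : iseq K r n -> D, weight_basis zeta lam v by exists D.
  move=> lam; have [lamQ|] := boolP (lam \in Cont2_quotient K r n); last first.
    by exists (zero_dmod K r n).
  have [lamS|lamS] := pselect (adm_stable lam); last first.
    by exists (zero_dmod K r n).
  have [lamC [w wl] _] := Cont2_quotientP lamQ.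
  exists (class_module charK r0 zeta_prim lamC lamS (exist [eta mem lam] w wl)).
  by move=> _ _; eexists; apply: class_module_weight_basis.
exists D; split=> [lam lamQ lamS|M repM irrM splM].
  have [v vb] := D_basis lam lamQ lamS.
  have [_ [w wl] lam_conn] := Cont2_quotientP lamQ.
  split; last by exists v.
  - exact: weight_basis_in_Rep_I vb.
  - exact: (weight_basis_irreducible zeta_prim vb lamS lam_conn wl).
  - exact: weight_basis_completely_splittable vb.
  - by move=> w'; apply: (weight_basis_weights zeta_prim vb).
have [lam [lamQ lamS isoM]] :=
  irreducible_iso_weight_basis charK r0 zeta_prim repM irrM splM.
exists lam; split=> //; have [v vb] := D_basis lam lamQ lamS.
have [_ [w wl] lam_conn] := Cont2_quotientP lamQ.
exact: isoM (weight_basis_irreducible zeta_prim vb lamS lam_conn wl) vb.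
Qed.
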